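(* For all integers $\alpha\ge 0$ and $n\ge 0$, \[ a\bigl(5^{2\alpha+2}n+\delta_\alpha\bigr)\equiv 0 \pmod{5^{\alpha+1}}, \] where $\delta_\alpha$ is the integer with $0\le \delta_\alpha<5^{2\alpha+2}$ and $8\delta_\alpha\equiv 1 \pmod{5^{2\alpha+2}}$.
   Context: The cubic partition function $a(n)$ is defined by $\sum_{n\ge 0}a(n)q^n=\prod_{n\ge 1}\frac{1}{(1-q^n)(1-q^{2n})}$. *)

(* Defs.v *)
From HB Require Import structures.
From mathcomp Require Import all_boot all_order all_algebra.
Set Implicit Arguments. Unset Strict Implicit. Unset Printing Implicit Defensive.
Import GRing.Theory.
Local Open Scope ring_scope.

(* Truncation (mod q^(n+1)) of the geometric series 1/(1 - q^k) = sum_i q^(k i):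
   sum_{i=0}^{n} q^(k i).  For k >= 1 this agrees with 1/(1-q^k) in all degrees <= n. *)
Definition geom_trunc (n k : nat) : {poly int} := \sum_(i < n.+1) 'X^(k * i).

(* The cubic partition function: a(n) is the coefficient of q^n in
   prod_{k>=1} 1/((1-q^k)(1-q^(2k))).  Factors with k > n contribute 1 + O(q^(n+1)),
   and each geometric series is truncated beyond degree n, which does not affect
   the coefficient of q^n. *)
Definition cubic_part (n : nat) : int :=
  (\prod_(1 <= k < n.+1) (geom_trunc n k * geom_trunc n (2 * k)))`_n.

(* Main.v *)
Require Import Defs.
From HB Require Import structures.
From mathcomp Require Import all_boot all_order all_algebra.
From mathcomp Require Import ring lra zify.
From mathcomp Require Import boolp.
Set Implicit Arguments. Unset Strict Implicit. Unset Printing Implicit Defensive.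
Import GRing.Theory.
Local Open Scope ring_scope.

(* Write [E_m] for the Euler product of [q^m], [F = E_1 E_2] and [F_m] for [F]
   with [q] replaced by [q^m]; [Z = q^3 F_25 / F], [t = q (F_5 / F)^2],
   [T = t(q^5)], and let [U] keep the coefficients of index divisible by 5, so
   that [U] is linear over series in [q^5].  Put
     [phi = E_1^2 / E_2 = sum_(n in Z) (-1)^n q^(n^2)],
     [psi = E_2^2 / E_1 = sum_(n >= 0) q^(n(n+1)/2)].
   Their 5-dissections [phi = phi_25 (1 + al + be)],
   [psi = q^3 psi_25 (1 + ga + de)] have terms of exponents 1, 4, 2, 3 mod 5.
   - By Jacobi's formula [E_1^3 = phi^2 psi] and [E_2^3 = phi psi^2] have no
     terms with exponents in certain classes mod 5, which gives four polynomial
     relations between [al, be, ga, de], and [al be ga de = -4].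
   - Multiplication by [2 + i] in the Gaussian integers gives
     [phi_25^2 (1 + al be) = phi_5^2] and its analogue for [psi], so that
     [1 / T = (1 + al be) (1 + ga de)].
   Since [1 / Z = (1 + al + be) (1 + ga + de)], elimination yields
     [Z^5 = (15 T + 125 T^2 + 625 T^3) Z^4 - (25 T^2 + 125 T^3) Z^3
            + (5 T^2 + 25 T^3) Z^2 - 5 T^3 Z + T^3],
   hence a linear recurrence for [U(Z^k)] with coefficients in [Z[t]], and the
   coefficient of [t^j] in [U(Z^k)] is divisible by [5^(floor((5j-1)/3) - k)].
   Because [Z^2 = t T], this controls [U(t^i)] and [U(Z t^i)]: on the span of
   the [5^floor((5j-5)/3) t^j], [j >= 1], the map [g |-> U(Z g)] is stable and
   [U] gains a factor 5.  Applying both to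
   [F q sum_n a(25^(k+1) n + d_k) q^n], where [8 d_k = 1 + 7 25^(k+1)], replaces
   [k] by [k + 1]. *)

(** * Formal power series *)

Record fps (R : Type) := Fps { coef : nat -> R }.

HB.instance Definition _ (R : Type) := gen_eqMixin (fps R).
HB.instance Definition _ (R : Type) := gen_choiceMixin (fps R).

Section FpsRing.
Variable R : idomainType.
Implicit Types f g h : fps R.

Lemma fpsP f g : (forall n, coef f n = coef g n) -> f = g.
Proof. by case: f g => f [g] /= /funext ->. Qed.

Definition fps_opp f := Fps (fun n => - coef f n).
Definition fps_add f g := Fps (fun n => coef f n + coef g n).
Definition fps_zero : fps R := Fps (fun=> 0).

Let fps_addA : associative fps_add.
Proof. by move=> f g h; apply: fpsP => n /=; rewrite addrA. Qed.

Let fps_addC : commutative fps_add.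
Proof. by move=> f g; apply: fpsP => n /=; rewrite addrC. Qed.

Let fps_add0 : left_id fps_zero fps_add.
Proof. by move=> f; apply: fpsP => n /=; rewrite add0r. Qed.

Let fps_addN : left_inverse fps_zero fps_opp fps_add.
Proof. by move=> f; apply: fpsP => n /=; rewrite addNr. Qed.

HB.instance Definition _ :=
  GRing.isZmodule.Build (fps R) fps_addA fps_addC fps_add0 fps_addN.

Definition trunc n f : {poly R} := \poly_(i < n.+1) coef f i.
Definition fps_mul f g :=
  Fps (fun n => \sum_(i < n.+1) coef f i * coef g (n - i)).
Definition fps_one : fps R := Fps (fun n => (n == 0)%:R).

Lemma coef_trunc n f i : (i <= n)%N -> (trunc n f)`_i = coef f i.
Proof. by move=> le_in; rewrite coef_poly ltnS le_in. Qed.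

(** Up to any given degree a product depends only on truncations, so the ring laws for series are
    inherited from polynomials. *)
Lemma coef_mul_trunc m n f g : (n <= m)%N ->
  coef (fps_mul f g) n = (trunc m f * trunc m g)`_n.
Proof.
move=> le_nm; rewrite coefM; apply: eq_bigr => -[i /=]; rewrite ltnS => le_in _.
by rewrite !coef_trunc //; lia.
Qed.

Lemma coefM_agree n (p p' r r' : {poly R}) :
  (forall i, (i <= n)%N -> p`_i = p'`_i) ->
  (forall i, (i <= n)%N -> r`_i = r'`_i) -> (p * r)`_n = (p' * r')`_n.
Proof.
move=> eq_p eq_r; rewrite !coefM; apply: eq_bigr => -[i /=]; rewrite ltnS => le_in _.
by rewrite eq_p // eq_r // leq_subr.
Qed.

Let trunc_mul n f g i : (i <= n)%N ->
  (trunc n (fps_mul f g))`_i = (trunc n f * trunc n g)`_i.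
Proof. by move=> le_in; rewrite coef_trunc // (coef_mul_trunc _ _ le_in). Qed.

Let fps_mulA : associative fps_mul.
Proof.
move=> f g h; apply: fpsP => n; rewrite !(coef_mul_trunc _ _ (leqnn n)).
rewrite (@coefM_agree n _ (trunc n f) _ (trunc n g * trunc n h)) //.
  by rewrite mulrA; apply: coefM_agree => // i; move/trunc_mul ->.
by move=> i; move/trunc_mul ->.
Qed.

Let fps_mulC : commutative fps_mul.
Proof. by move=> f g; apply: fpsP => n; rewrite !(coef_mul_trunc _ _ (leqnn n)) mulrC. Qed.

Let fps_mul1 : left_id fps_one fps_mul.
Proof.
move=> f; apply: fpsP => n /=; rewrite big_ord_recl /= subn0 mul1r big1 ?addr0 //.
by move=> i _; rewrite mul0r.
Qed.

Let fps_mulD : left_distributive fps_mul fps_add.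
Proof.
move=> f g h; apply: fpsP => n /=; rewrite -big_split /=.
by apply: eq_bigr => i _; rewrite mulrDl.
Qed.

Let fps_1neq0 : fps_one != 0.
Proof.
by apply/eqP => /(congr1 (fun f => coef f 0)) /= /eqP; rewrite oner_eq0.
Qed.

HB.instance Definition _ := GRing.Zmodule_isComNzRing.Build (fps R)
  fps_mulA fps_mulC fps_mul1 fps_mulD fps_1neq0.

Lemma fcoefD f g n : coef (f + g) n = coef f n + coef g n. Proof. by []. Qed.

Lemma fcoefN f n : coef (- f) n = - coef f n. Proof. by []. Qed.

Lemma fcoef0 n : coef (0 : fps R) n = 0. Proof. by []. Qed.

Lemma fcoef1 n : coef (1 : fps R) n = (n == 0)%:R. Proof. by []. Qed.

Lemma fcoefM f g n :
  coef (f * g) n = \sum_(i < n.+1) coef f i * coef g (n - i).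
Proof. by []. Qed.

Lemma fcoefMn f m n : coef (f *+ m) n = coef f n *+ m.
Proof. by elim: m => // m IHm; rewrite !mulrS fcoefD IHm. Qed.

Lemma fcoef_sum I (r : seq I) (P : pred I) (F : I -> fps R) n :
  coef (\sum_(i <- r | P i) F i) n = \sum_(i <- r | P i) coef (F i) n.
Proof. by elim/big_rec2: _ => // i x y _ <-. Qed.

(** Units are the series that have an inverse, and the inverse is picked by choice; the criterion
    used in practice is [fps_unitP]. *)
Let fps_unit f := `[< exists g, g * f = 1 >].
Let fps_inv f := if pselect (exists g, g * f = 1) is left ex then projT1 (cid ex) else f.
Let fps_mulV : {in fps_unit, left_inverse 1 fps_inv *%R}.
Proof.
move=> f /asboolP ex; rewrite /fps_inv; case: pselect => // ex'.
by case: cid.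
Qed.

Let fps_unitPl f g : g * f = 1 -> fps_unit f.
Proof. by move=> gen_series; apply/asboolP; exists g. Qed.

Let fps_inv_out : {in [predC fps_unit], fps_inv =1 id}.
Proof. by move=> f /asboolP nex; rewrite /fps_inv; case: pselect. Qed.

HB.instance Definition _ := GRing.ComNzRing_hasMulInverse.Build (fps R)
  fps_mulV fps_unitPl fps_inv_out.

(** If the lowest nonzero coefficients of [f] and [g] sit at [i] and [j], their product is the
    coefficient of [f * g] at [i + j]. *)
Lemma fps_mulf_eq0 : GRing.integral_domain_axiom (fps R).
Proof.
move=> f g fg0; apply/orP; case: (boolP (f == 0)) => [|nf0]; [by left | right].
apply: contraT => ng0.
have nz h : h != 0 -> exists n, coef h n != 0.
  move=> h0; apply: contrapT => /forallNP h_eq0; case/eqP: h0; apply: fpsP => n.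
  by apply/eqP/negPn/negP/h_eq0.
case: (ex_minnP (nz _ nf0)) => i fi0 min_i; case: (ex_minnP (nz _ ng0)) => j gj0 min_j.
have /eqP := congr1 (fun h => coef h (i + j)) fg0; rewrite fcoefM fcoef0.
rewrite (bigD1 (inord i)) //= inordK ?ltnS ?leq_addr // big1.
  by rewrite addr0 addKn mulf_eq0 (negPf fi0) (negPf gj0).
move=> k ki; have [lt_ki|le_ik] := ltnP k i.
  have [->|/min_i] := eqVneq (coef f k) 0; first by rewrite mul0r.
  by rewrite leqNgt lt_ki.
have lt_ik : (i < k)%N.
  rewrite ltn_neqAle le_ik andbT; apply: contra ki => /eqP ik; apply/eqP/val_inj.
  by rewrite /= inordK ?ltnS ?leq_addr.
have [->|/min_j] := eqVneq (coef g (i + j - k)) 0; first by rewrite mulr0.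
by have := ltn_ord k; lia.
Qed.

HB.instance Definition _ := GRing.ComUnitRing_isIntegral.Build (fps R) fps_mulf_eq0.

End FpsRing.

(** * Agreement up to a degree, dilations and sections of series *)

Section FpsOps.
Variable R : idomainType.
Implicit Types f g h : fps R.

Definition fq : fps R := Fps (fun n => (n == 1)%:R).

Lemma fcoefB f g n : coef (f - g) n = coef f n - coef g n.
Proof. by []. Qed.

Lemma fcoefqM f n : coef (fq * f) n = if n is m.+1 then coef f m else 0.
Proof.
rewrite fcoefM; case: n => [|n]; rewrite big_ord_recl /= mul0r add0r ?big_ord0 //.
rewrite big_ord_recl /= mul1r subn1 big1 ?addr0 // => i _.
by rewrite mul0r.
Qed.

Lemma fcoefqXM k f n :
  coef (fq ^+ k * f) n = if (n < k)%N then 0 else coef f (n - k).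
Proof.
elim: k n => [|k IHk] n; first by rewrite mul1r subn0.
by rewrite exprS -mulrA fcoefqM; case: n => // n; rewrite IHk ltnS subSS.
Qed.

Lemma fcoefqX k n : coef (fq ^+ k) n = (n == k)%:R.
Proof.
rewrite -[_ ^+ k]mulr1 fcoefqXM fcoef1; case: ltngtP => // [lt_kn|->]; last by rewrite subnn.
by rewrite subn_eq0 leqNgt lt_kn.
Qed.

Lemma fq_neq0 : fq != 0.
Proof. by apply/eqP => /(congr1 (fun f => coef f 1)) /eqP; rewrite /= oner_eq0. Qed.

Definition agree N f g := forall i, (i < N)%N -> coef f i = coef g i.

Lemma agree_refl N f : agree N f f. Proof. by []. Qed.

Lemma agree_sym N f g : agree N f g -> agree N g f.
Proof. by move=> fg i /fg. Qed.

Lemma agree_trans N f g h : agree N f g -> agree N g h -> agree N f h.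
Proof. by move=> fg gh i lt_i; rewrite fg ?gh. Qed.

Lemma agreeW M N f g : (M <= N)%N -> agree N f g -> agree M f g.
Proof. by move=> le_MN fg i lt_i; rewrite fg // (leq_trans lt_i). Qed.

Lemma agree_eq f g : (forall N, agree N f g) -> f = g.
Proof. by move=> fg; apply: fpsP => n; apply: (fg n.+1). Qed.

Lemma agreeM N f f' g g' :
  agree N f f' -> agree N g g' -> agree N (f * g) (f' * g').
Proof.
move=> eq_f eq_g n lt_n; rewrite !fcoefM; apply: eq_bigr => -[i /=].
by rewrite ltnS => le_in _; rewrite eq_f ?eq_g //; lia.
Qed.

Lemma agree_sum N I (r : seq I) (P : pred I) (F G : I -> fps R) :
  (forall i, P i -> agree N (F i) (G i)) ->
  agree N (\sum_(i <- r | P i) F i) (\sum_(i <- r | P i) G i).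
Proof. by move=> FG n lt_n; rewrite !fcoef_sum; apply: eq_bigr => i /FG ->. Qed.

Lemma agree_prod N I (r : seq I) (P : pred I) (F G : I -> fps R) :
  (forall i, P i -> agree N (F i) (G i)) ->
  agree N (\prod_(i <- r | P i) F i) (\prod_(i <- r | P i) G i).
Proof. by move=> FG; elim/big_rec2: _ => // i x y Pi; apply: agreeM; apply: FG. Qed.

Lemma agree_qX N k : (N <= k)%N -> agree N (fq ^+ k) 0.
Proof. by move=> le_Nk i lt_iN; rewrite fcoefqX fcoef0; case: eqP => //; lia. Qed.

(** The inverse is the geometric series in [h = 1 - f], which converges coefficientwise because
    [h ^+ k] has order at least [k]. *)
Lemma fps_unitP f : coef f 0 = 1 -> f \is a GRing.unit.
Proof.
move=> f0; pose h := 1 - f.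
have h0 : coef h 0 = 0 by rewrite fcoefB fcoef1 f0 subrr.
have hX k : agree k (h ^+ k) 0.
  elim: k => [|k IHk] [|i] lt_i //; rewrite exprS.
    by rewrite fcoefM big_ord1 h0 mul0r.
  rewrite fcoefM big_ord_recl h0 mul0r add0r big1 // => j _ /=.
  by rewrite IHk ?fcoef0 ?mulr0 //; rewrite /bump /=; lia.
pose g := Fps (fun n => coef (\sum_(k < n.+1) h ^+ k) n).
have gE N : agree N g (\sum_(k < N) h ^+ k).
  move=> i lt_iN /=; rewrite (big_ord_widen_cond _ xpredT (fun k => h ^+ k) lt_iN) big_mkcond.
  rewrite !fcoef_sum; apply: eq_bigr => k _ /=; case: ltnP => // lt_ik.
  by rewrite (hX k i lt_ik).
suff gen_series : g * f = 1 by apply/unitrPr; exists g; rewrite mulrC.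
apply: agree_eq => N; apply: (agree_trans (agreeM (gE N) (@agree_refl N f))).
have -> : f = 1 - h by rewrite /h; ring.
rewrite -[_ * _]opprK mulrC -mulNr opprB -subrX1 opprB => i lt_i.
by rewrite fcoefB hX // fcoef0 subr0.
Qed.

Lemma agree_cancel N f g h : coef h 0 = 1 ->
  agree N (f * h) (g * h) -> agree N f g.
Proof.
move=> /fps_unitP uh fg; rewrite -(mulrK uh f) -(mulrK uh g).
exact: agreeM.
Qed.

(** The substitution of [q^d] for [q]. For [d = 0] the conventions of division leave the constant
    term alone, which is again a ring morphism. *)
Definition dil d f := Fps (fun n => if (d %| n)%N then coef f (n %/ d) else 0).

Lemma coef_dil_trunc d f m n : (0 < d)%N -> (n <= m)%N ->
  coef (dil d f) n = (trunc m f \Po 'X^d)`_n.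
Proof.
move=> d0 le_nm; rewrite coef_comp_poly_Xn //=; case: ifP => // _.
by rewrite coef_trunc // (leq_trans (leq_div _ _)).
Qed.

Lemma dil0E f : dil 0 f = Fps (fun n => if n == 0 then coef f 0 else 0).
Proof. by apply: fpsP => n /=; rewrite dvd0n divn0. Qed.

Lemma dil_is_zmod_morphism d : zmod_morphism (dil d).
Proof. by move=> f g; apply: fpsP => n; rewrite fcoefB /=; case: ifP; rewrite ?subr0. Qed.

Lemma dil_is_monoid_morphism d : monoid_morphism (dil d).
Proof.
split=> [|f g]; apply: fpsP => n.
  rewrite /=; case: d => [|d]; first by rewrite dvd0n divn0; case: eqP.
  case: ifP => [/dvdnP [k ->]|]; last by case: n.
  by rewrite mulnK // muln_eq0 orbF.
have [->|d0] := posnP d.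
  rewrite !dil0E fcoefM; case: n => [|n] /=; first by rewrite !big_ord1.
  by rewrite big1 // => -[[|i] lt_i] _ /=; rewrite ?mulr0 ?mul0r.
rewrite (coef_dil_trunc _ d0 (leqnn n)) (@coef_mul_trunc _ n n) //.
transitivity (((trunc n f * trunc n g) \Po 'X^d)`_n).
  rewrite !coef_comp_poly_Xn //; case: ifP => // _; have le := leq_div n d.
  by rewrite coef_trunc // (@coef_mul_trunc _ n).
rewrite comp_polyM; apply: coefM_agree => i le_in;
  by rewrite [RHS]coef_trunc // (coef_dil_trunc _ d0 le_in).
Qed.

HB.instance Definition _ d :=
  GRing.isZmodMorphism.Build (fps R) (fps R) (dil d) (dil_is_zmod_morphism d).
HB.instance Definition _ d :=
  GRing.isMonoidMorphism.Build (fps R) (fps R) (dil d) (dil_is_monoid_morphism d).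

Lemma coef_dil_mul d f n : (0 < d)%N -> coef (dil d f) (d * n) = coef f n.
Proof. by move=> d0; rewrite /= dvdn_mulr // mulKn. Qed.

Lemma dil_inj d : (0 < d)%N -> injective (dil d).
Proof. by move=> d0 f g fg; apply: fpsP => n; rewrite -(coef_dil_mul f n d0) fg coef_dil_mul. Qed.

Lemma dil_neq0 d f : (0 < d)%N -> f != 0 -> dil d f != 0.
Proof. by move=> d0 f0; rewrite -(rmorph0 (dil d)) (inj_eq (dil_inj d0)). Qed.

Lemma dil1 f : dil 1 f = f.
Proof. by apply: fpsP => k; rewrite /= dvd1n divn1. Qed.

Lemma dil_dil d e f : (0 < d)%N -> (0 < e)%N -> dil d (dil e f) = dil (d * e) f.
Proof.
move=> d0 e0; apply: fpsP => n /=; case: (boolP (d %| n)%N) => [/dvdnP [m ->]|ndn].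
  by rewrite mulnK // [(d * e)%N]mulnC dvdn_pmul2r // divnMr.
by case: ifP => // de; case/negP: ndn; apply: dvdn_trans de; apply: dvdn_mulr.
Qed.

Lemma dil_fq d : (0 < d)%N -> dil d fq = fq ^+ d.
Proof.
move=> d0; apply: fpsP => n; rewrite fcoefqX /=; case: ifP => [/dvdnP [k ->]|].
  by rewrite mulnK // -[X in _ = (_ == X)%:R]mul1n eqn_pmul2r.
by case: eqP => // ->; rewrite dvdnn.
Qed.

Lemma agree_dil d N f g : (0 < d)%N -> agree N f g -> agree N (dil d f) (dil d g).
Proof.
move=> d0 fg i lt_i /=; case: ifP => // _; apply: fg.
by rewrite (leq_ltn_trans (leq_div _ _)).
Qed.

(* Atkin's operator U_d. *)
Definition sect d f := Fps (fun n => coef f (d * n)).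

Lemma sect_is_zmod_morphism d : zmod_morphism (sect d).
Proof. by move=> f g; apply: fpsP. Qed.

HB.instance Definition _ d :=
  GRing.isZmodMorphism.Build (fps R) (fps R) (sect d) (sect_is_zmod_morphism d).

Lemma sect_dil d f : (0 < d)%N -> sect d (dil d f) = f.
Proof. by move=> d0; apply: fpsP => n; rewrite /= dvdn_mulr // mulKn. Qed.

Definition fps_of_poly (p : {poly R}) := Fps (fun n => p`_n).

Lemma fps_of_poly_is_zmod_morphism : zmod_morphism fps_of_poly.
Proof. by move=> p r; apply: fpsP => n; rewrite fcoefB /= coefB. Qed.

Lemma fps_of_poly_is_monoid_morphism : monoid_morphism fps_of_poly.
Proof.
split=> [|p r]; apply: fpsP => n; first by rewrite /= coefC; case: n.
by rewrite fcoefM /= coefM.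
Qed.

HB.instance Definition _ :=
  GRing.isZmodMorphism.Build {poly R} (fps R) fps_of_poly fps_of_poly_is_zmod_morphism.
HB.instance Definition _ :=
  GRing.isMonoidMorphism.Build {poly R} (fps R) fps_of_poly fps_of_poly_is_monoid_morphism.

Lemma fps_of_polyX : fps_of_poly 'X = fq.
Proof. by apply: fpsP => n; rewrite /= coefX. Qed.

(** * Grading of series by the exponent modulo 5 *)

Definition homog i f := forall n, n != i %[mod 5] -> coef f n = 0.
Definition comp i f := Fps (fun n => if n == i %[mod 5] then coef f n else 0).

Lemma comp_is_zmod_morphism i : zmod_morphism (comp i).
Proof. by move=> f g; apply: fpsP => n; rewrite fcoefB /=; case: ifP; rewrite ?subr0. Qed.

HB.instance Definition _ i :=
  GRing.isZmodMorphism.Build (fps R) (fps R) (comp i) (comp_is_zmod_morphism i).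

Lemma comp_homog i f : homog i (comp i f).
Proof. by move=> n /= /negPf ->. Qed.

Lemma homog_comp i f : homog i f -> comp i f = f.
Proof. by move=> hf; apply: fpsP => n /=; case: ifP => // /negbT /hf. Qed.

Lemma homog_comp0 i j f : homog i f -> i != j %[mod 5] -> comp j f = 0.
Proof.
move=> hf ij; apply: fpsP => n /=; case: ifP => // /eqP nj; apply: hf.
by apply: contra ij => /eqP ni; rewrite -ni nj.
Qed.

Lemma comp_sum f : f = comp 0 f + comp 1 f + comp 2 f + comp 3 f + comp 4 f.
Proof.
apply: fpsP => n; rewrite !fcoefD /=.
have := ltn_pmod n (isT : (0 < 5)%N).
by case: (n %% 5)%N => [|[|[|[|[|]]]]] //=; rewrite ?(addr0, add0r).
Qed.

Lemma homogD i f g : homog i f -> homog i g -> homog i (f + g).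
Proof. by move=> hf hg n ni; rewrite fcoefD hf ?hg ?addr0. Qed.

Lemma homogM i j f g : homog i f -> homog j g -> homog (i + j) (f * g).
Proof.
move=> hf hg n nij; rewrite fcoefM big1 // => -[k /=]; rewrite ltnS => le_kn _.
have [ki|/hf ->] := eqVneq (k %% 5)%N (i %% 5)%N; last by rewrite mul0r.
rewrite hg ?mulr0 //; apply: contra nij => /eqP nkj.
by rewrite -(subnKC le_kn) -modnDm ki nkj modnDm.
Qed.

Lemma homog_dil f : homog 0 (dil 5 f).
Proof. by move=> n; rewrite mod0n /= -/(dvdn 5 n) => /negPf ->. Qed.

Lemma dil_sect f : dil 5 (sect 5 f) = comp 0 f.
Proof.
apply: fpsP => n /=; rewrite mod0n -/(dvdn 5 n); case: ifP => // /dvdnP [m ->].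
by rewrite mulnK // mulnC.
Qed.

(** Series in [q^5] have degree 0 for the grading, so multiplying by them preserves each of the five
    components of [f]. *)
Lemma comp_dilM i f g : comp i (dil 5 g * f) = dil 5 g * comp i f.
Proof.
rewrite [in LHS](comp_sum f) !mulrDr !raddfD /=.
have H j : comp i (dil 5 g * comp j f) = if (i == j %[mod 5])%N then dil 5 g * comp i f else 0.
  have h : homog j (dil 5 g * comp j f) by apply: (homogM (homog_dil g) (@comp_homog j f)).
  case: eqP => [ij|/eqP ij]; last by apply: (homog_comp0 h); rewrite eq_sym.
  have -> : comp i f = comp j f by apply: fpsP => n; rewrite /= ij.
  by apply: homog_comp => n; rewrite ij; apply: h.
rewrite !H; have := ltn_pmod i (isT : (0 < 5)%N).
by case: (i %% 5)%N => [|[|[|[|[|]]]]] //=; rewrite ?(addr0, add0r).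
Qed.

(** Applying the injective map [dil 5] turns the section into the projection [comp 0], which is
    linear over series in [q^5]. *)
Lemma sect_dilM f g : sect 5 (dil 5 g * f) = g * sect 5 f.
Proof.
by apply: (@dil_inj 5) => //; rewrite dil_sect rmorphM /= dil_sect comp_dilM. Qed.

End FpsOps.
Arguments fq {R}.

(** * Finite forms of the Jacobi triple product *)

Section FiniteJacobi.
Variables (A : comNzRingType) (x : A).

Definition qfact n := \prod_(i < n) (1 - x ^+ i.+1).

(* The Gaussian binomial coefficient [2n+1 choose n-j] in base [x], and 0 for
   [j > n]; at [j = 0] the predecessor [j.-1 = 0] encodes the symmetry
   [2n+1 choose n+1] = [2n+1 choose n]. *)
Fixpoint cgauss n j : A :=
  if n is m.+1 then
    (1 + x ^+ (2 * m.+1)) * cgauss m j + x ^+ (m.+1 - j) * cgauss m j.-1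
    + x ^+ (m.+2 + j) * cgauss m j.+1
  else (j == 0)%:R.

Lemma cgaussS n j : cgauss n.+1 j =
  (1 + x ^+ (2 * n.+1)) * cgauss n j + x ^+ (n.+1 - j) * cgauss n j.-1
    + x ^+ (n.+2 + j) * cgauss n j.+1.
Proof. by []. Qed.

Lemma cgauss_gt n j : (n < j)%N -> cgauss n j = 0.
Proof.
elim: n j => [|n IHn] [|j] //= lt_nj.
by rewrite !IHn ?mulr0 ?addr0 //; lia.
Qed.

Lemma cgauss_diag n : cgauss n n = 1.
Proof.
elim: n => // n IHn; rewrite cgaussS IHn !cgauss_gt // subnn; ring.
Qed.

Lemma qfact0 : qfact 0 = 1. Proof. exact: big_ord0. Qed.

Lemma qfactS n : qfact n.+1 = qfact n * (1 - x ^+ n.+1).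
Proof. by rewrite /qfact big_ord_recr. Qed.

(** The product formula for Gaussian binomials in division-free form. Multiplied by the common
    denominator [P], each of the three terms of the recurrence becomes [Q] times two linear
    factors. *)
Lemma cgaussE n j : (j <= n)%N ->
  cgauss n j * (qfact (n - j) * qfact (n + j).+1) = qfact (2 * n).+1.
Proof.
elim: n j => [|n IHn] j.
  by rewrite leqn0 => /eqP -> /=; rewrite qfact0 !mul1r.
rewrite leq_eqVlt => /predU1P [->|].
  by rewrite cgauss_diag subnn qfact0 !mul1r addnn mul2n.
rewrite ltnS => le_jn.
set P := qfact _ * _; set Q := qfact (2 * n).+1 in IHn.
have T0 : cgauss n j * P = Q * (1 - x ^+ (n.+1 - j)) * (1 - x ^+ (n.+2 + j)).
  by rewrite -(IHn j) // /P subSn // !addSn !qfactS; ring.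
have T1 : cgauss n j.-1 * P = Q * (1 - x ^+ (n.+1 + j)) * (1 - x ^+ (n.+2 + j)).
  case: j le_jn @P T0 => [|j] le_jn P T0 /=; first by rewrite T0 subn0 !addn0.
  rewrite -(IHn j); last by rewrite ltnW.
  by rewrite /P subSS !addSn !addnS !qfactS; ring.
have T2 : cgauss n j.+1 * P = Q * (1 - x ^+ (n - j)) * (1 - x ^+ (n.+1 - j)).
  have [lt_jn|le_nj] := ltnP j n; last first.
    have -> : (n - j)%N = 0 by lia.
    by rewrite cgauss_gt // expr0 subrr mulr0 !mul0r.
  rewrite -(IHn j.+1) // /P subSn // [X in qfact X.+1](_ : _ = (n - j.+1).+1); last by lia.
  by rewrite (_ : (n - j)%N = (n - j.+1).+1) ?addSn ?addnS ?qfactS; [ring | lia].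
have -> : cgauss n.+1 j * P = (1 + x ^+ (2 * n.+1)) * (cgauss n j * P)
    + x ^+ (n.+1 - j) * (cgauss n j.-1 * P) + x ^+ (n.+2 + j) * (cgauss n j.+1 * P).
  by rewrite cgaussS; ring.
have -> : (2 * n.+1).+1 = (2 * n).+3 by lia.
rewrite T0 T1 T2 2!qfactS -/Q -(subnK le_jn).
move: (n - j)%N => k; rewrite addnK.
have -> : ((k + j).+1 - j)%N = k.+1 by lia.
(* With [k = n - j], what remains is a polynomial identity in [x], [x ^+ k] and [x ^+ j]; every
   power is rewritten in these. *)
have e1 : x ^+ ((k + j).+2 + j) = x ^+ 2 * x ^+ k * x ^+ j ^+ 2.
  by rewrite -exprM -!exprD; congr (_ ^+ _); lia.
have e2 : x ^+ ((k + j).+1 + j) = x * x ^+ k * x ^+ j ^+ 2.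
  by rewrite -exprM -exprS -!exprD; congr (_ ^+ _); lia.
have e3 : x ^+ (2 * (k + j)).+2 = x ^+ 2 * x ^+ k ^+ 2 * x ^+ j ^+ 2.
  by rewrite -!exprM -!exprD; congr (_ ^+ _); lia.
have e4 : x ^+ (2 * (k + j)).+3 = x ^+ 3 * x ^+ k ^+ 2 * x ^+ j ^+ 2.
  by rewrite -!exprM -!exprD; congr (_ ^+ _); lia.
have e5 : x ^+ (2 * (k + j).+1) = x ^+ (2 * (k + j)).+2 by congr (_ ^+ _); lia.
by rewrite e5 e1 e2 e3 e4 (exprS x k); ring.
Qed.

Lemma tri_succ j : 'C(j.+2, 2) = ('C(j.+1, 2) + j.+1)%N.
Proof. by rewrite binS bin1. Qed.

Variable z : A.

(** Induction on [n]: the new factor is [(1 + x^(2n+2)) z + x^(n+1) (1 + z^2)], and multiplication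
    by [z] and by [1 + z^2] sends the folded pair of powers of index [j] to [h j] and to
    [h j.+1 + h j.-1]. This matches the recurrence of [cgauss]. *)
Lemma finite_jacobi n :
  (1 + z) * \prod_(i < n) ((x ^+ i.+1 + z) * (1 + x ^+ i.+1 * z)) =
  \sum_(j < n.+1) x ^+ 'C(j.+1, 2) * cgauss n j * (z ^+ (n.+1 + j) + z ^+ (n - j)).
Proof.
elim: n => [|n IHn]; first by rewrite big_ord0 big_ord1 /= addn0; ring.
pose a j := x ^+ 'C(j.+1, 2) * cgauss n j.
pose h j := z ^+ (n.+2 + j) + z ^+ (n.+1 - j).
have a_gt j : (n < j)%N -> a j = 0 by move=> lt_nj; rewrite /a cgauss_gt ?mulr0.
have aS j : (j <= n.+1)%N -> x ^+ 'C(j.+1, 2) * cgauss n.+1 j =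
    (1 + x ^+ (2 * n.+1)) * a j + x ^+ n.+1 * (a j.-1 + a j.+1).
  move=> le_jn; rewrite cgaussS /a tri_succ.
  have -> : x ^+ ('C(j.+1, 2) + j.+1) = x ^+ 'C(j.+1, 2) * x ^+ j.+1 by rewrite exprD.
  have -> : x ^+ (n.+2 + j) = x ^+ n.+1 * x ^+ j.+1 by rewrite -exprD; congr (_ ^+ _); lia.
  case: j le_jn => [|j] le_jn /=; first by rewrite subn0; ring.
  have e : x ^+ 'C(j.+2, 2) * x ^+ (n.+1 - j.+1) = x ^+ n.+1 * x ^+ 'C(j.+1, 2).
    by rewrite tri_succ -!exprD; congr (_ ^+ _); lia.
  rewrite !mulrDr [_ * (x ^+ (n.+1 - _) * _)]mulrA e; ring.
rewrite big_ord_recr /= mulrA IHn.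
transitivity (\sum_(j < n.+1) ((1 + x ^+ (2 * n.+1)) * (a j * h j)
   + x ^+ n.+1 * (a j * h j.+1) + x ^+ n.+1 * (a j * h j.-1))).
  rewrite big_distrl /=; apply: eq_bigr => -[j /=]; rewrite ltnS => le_jn _.
  rewrite -/(a j).
  have -> : x ^+ (2 * n.+1) = x ^+ n.+1 ^+ 2 by rewrite -exprM mulnC.
  have h0 : z * (z ^+ (n.+1 + j) + z ^+ (n - j)) = h j.
    by rewrite mulrDr -!exprS /h -subSn.
  (* At [j = 0] the formula for [h] would give [h (-1) = h 0], in agreement with [0.-1 = 0]. *)
  have h1 : (1 + z ^+ 2) * (z ^+ (n.+1 + j) + z ^+ (n - j)) = h j.+1 + h j.-1.
    rewrite mulrDl mul1r mulrDr -!exprD /h; case: j le_jn {h0} => [|j] le_jn /=.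
      by rewrite !subn0 !addn0 subSS subn0 !add2n addn1; ring.
    by rewrite subSS !addnS !addSn !add0n (_ : (n - j.+1).+2 = (n.+1 - j)%N); [ring|lia].
  transitivity (a j * ((1 + x ^+ n.+1 ^+ 2) * (z * (z ^+ (n.+1 + j) + z ^+ (n - j)))
     + x ^+ n.+1 * ((1 + z ^+ 2) * (z ^+ (n.+1 + j) + z ^+ (n - j))))); first by ring.
  by rewrite h0 h1; ring.
(* Summation by parts moves the index shifts from [h] to [a]. The terms beyond [n] vanish, and the
   boundary term [a 0 * h 0] appears on both sides. *)
transitivity (\sum_(j < n.+2) ((1 + x ^+ (2 * n.+1)) * (a j * h j)
   + x ^+ n.+1 * (a j.-1 * h j) + x ^+ n.+1 * (a j.+1 * h j))); last first.
  apply: eq_bigr => -[j /=]; rewrite ltnS => le_jn _.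
  by rewrite aS // /h; ring.
rewrite !big_split /= -!big_distrr /=.
have recl m F : \sum_(j < m.+1) F (nat_of_ord j) = F 0 + \sum_(j < m) F j.+1 :> A.
  by rewrite big_ord_recl.
rewrite [X in _ = _ * X + _ + _]big_ord_recr /= (a_gt n.+1) // mul0r addr0.
rewrite (recl _ (fun j => a j.-1 * h j)) (recl _ (fun j => a j * h j.-1)) /=.
rewrite [X in _ = _ + _ + _ * X]big_ord_recr /= (a_gt n.+2) // mul0r addr0.
by rewrite [X in _ = _ + _ + _ * X]big_ord_recr /= (a_gt n.+1) // mul0r addr0; ring.
Qed.

End FiniteJacobi.

Lemma rmorph_qfact (A B : comNzRingType) (f : {rmorphism A -> B}) x n :
  f (qfact x n) = qfact (f x) n.
Proof.
rewrite rmorph_prod; apply: eq_bigr => i _.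
by rewrite rmorphB rmorph1 rmorphXn.
Qed.

Lemma rmorph_cgauss (A B : comNzRingType) (f : {rmorphism A -> B}) x n j :
  f (cgauss x n j) = cgauss (f x) n j.
Proof.
elim: n j => [|n IHn] j; first by rewrite /= rmorph_nat.
by rewrite !cgaussS !(rmorphD, rmorphM, rmorphXn, rmorph1, IHn).
Qed.

(** The factor [1 + z] is cancelled for an indeterminate, where it is nonzero, and [z] is
    substituted afterwards. This permits [z = -1], the value that yields Jacobi's formula for the
    cube. *)
Lemma finite_jacobi_quot (A : idomainType) (x z : A) n :
  \prod_(i < n) ((x ^+ i.+1 + z) * (1 + x ^+ i.+1 * z)) =
  \sum_(j < n.+1) x ^+ 'C(j.+1, 2) * cgauss x n j *
     (z ^+ (n - j) * \sum_(i < (2 * j).+1) (- z) ^+ i).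
Proof.
have X1 : 1 + 'X != 0 :> {poly A} by rewrite addrC -polyC1 -size_poly_eq0 size_XaddC.
have := finite_jacobi x%:P 'X n.
have -> : \sum_(j < n.+1) x%:P ^+ 'C(j.+1, 2) * cgauss x%:P n j * ('X ^+ (n.+1 + j) + 'X ^+ (n - j))
   = (1 + 'X) * \sum_(j < n.+1) x%:P ^+ 'C(j.+1, 2) * cgauss x%:P n j *
     ('X ^+ (n - j) * \sum_(i < (2 * j).+1) (- 'X) ^+ i).
  rewrite big_distrr; apply: eq_bigr => -[j /=]; rewrite ltnS => le_jn _.
  rewrite mulrCA; congr (_ * _); rewrite mulrCA.
  have -> : (1 + 'X) * (\sum_(i < (2 * j).+1) (- 'X) ^+ i) = 1 + 'X ^+ (2 * j).+1 :> {poly A}.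
    have := subrX1 (- 'X : {poly A}) (2 * j).+1; rewrite exprNn -signr_odd oddS oddM /= => h.
    by apply: oppr_inj; rewrite -mulNr opprD [- 1 - 'X]addrC -h; ring.
  by rewrite mulrDr mulr1 addrC -exprD; congr (_ + 'X ^+ _); lia.
move/(mulfI X1)/(congr1 (horner_eval z)).
rewrite rmorph_prod rmorph_sum /= => h.
transitivity (\prod_(i < n) horner_eval z ((x%:P ^+ i.+1 + 'X) * (1 + x%:P ^+ i.+1 * 'X))).
  by apply: eq_bigr => i _; rewrite /horner_eval !hornerE.
rewrite h; apply: eq_bigr => j _.
rewrite !rmorphM /= -(rmorph_cgauss (@polyC A)) !rmorphXn /= rmorph_sum /=.
rewrite /horner_eval !hornerE /= ; congr (_ * _).
by apply: eq_bigr => i _; rewrite horner_exp !hornerE.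
Qed.

Lemma signr_sub (A : pzRingType) n j : (j <= n)%N ->
  (-1) ^+ (n - j) = (-1) ^+ n * (-1) ^+ j :> A.
Proof. by move=> le_jn; rewrite -signr_odd oddB // signr_addb !signr_odd. Qed.

(** * Product formulas for [phi], [psi] and the cube of the Euler product *)

Section ThetaProducts.
Variable R : idomainType.
Notation q := (fq : fps R).

Lemma agreeB0 N (f g : fps R) : agree N (f - g) 0 <-> agree N f g.
Proof.
split=> fg i lt_i; have := fg i lt_i; rewrite fcoefB fcoef0; first by move/subr0_eq.
by move=> ->; rewrite subrr.
Qed.

Lemma agreeM0 a b (f g : fps R) : agree a f 0 -> agree b g 0 -> agree (a + b) (f * g) 0.
Proof.
move=> f0 g0 n lt_n; rewrite fcoefM big1 // => -[i /=]; rewrite ltnS => le_in _.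
have [lt_ia|le_ai] := ltnP i a; first by rewrite f0 // mul0r.
by rewrite g0 ?mulr0 //; lia.
Qed.

(* The sum of the series [F j], meaningful when [F j] has order at least [j]. *)
Definition fsum (F : nat -> fps R) := Fps (fun n => coef (\sum_(j < n.+1) F j) n).

Lemma fsumP (F : nat -> fps R) M N : (forall j, agree j (F j) 0) -> (N <= M)%N ->
  agree N (fsum F) (\sum_(j < M) F j).
Proof.
move=> F0 le_NM i lt_i /=; have lt_iM : (i < M)%N by lia.
rewrite (big_ord_widen_cond _ xpredT F lt_iM) big_mkcond /=.
rewrite !fcoef_sum; apply: eq_bigr => k _ /=; case: ltnP => // lt_ik.
by rewrite (F0 k i).
Qed.

(* The diagonal coefficients are those of the infinite product, by [agree_qfact]. *)
Definition euler : fps R := Fps (fun n => coef (qfact q n) n).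

Lemma agree_qfact n k : agree n.+1 (qfact q (n + k)) (qfact q n).
Proof.
elim: k => [|k IHk]; rewrite ?addn0 // addnS qfactS.
apply: agree_trans IHk; apply/agreeB0; rewrite mulrBr mulr1 addrAC subrr add0r.
move=> i lt_i; rewrite fcoefN fcoef0 mulrC fcoefqXM ifT ?oppr0 //; lia.
Qed.

Lemma agree_euler b N M : (0 < b)%N -> (N <= M.+1)%N ->
  agree N (dil b euler) (qfact (q ^+ b) M).
Proof.
move=> b0 le_NM; rewrite -(dil_fq _ b0) -rmorph_qfact; apply: agree_dil => //.
move=> i lt_i /=; have -> : M = (i + (M - i))%N by lia.
by rewrite agree_qfact.
Qed.

Lemma euler0 b : (0 < b)%N -> coef (dil b euler) 0 = 1.
Proof. by move=> b0; rewrite /= dvdn0 div0n qfact0. Qed.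

(** As [n] grows the three q-factorials in [cgaussE] all tend to the Euler product, so [cgauss]
    tends to its inverse. *)
Lemma agree_cgauss b n j : (0 < b)%N -> (j <= n)%N ->
  agree (n - j).+1 (cgauss (q ^+ b) n j * dil b euler) 1.
Proof.
move=> b0 le_jn; apply: (agree_cancel (euler0 b0)); rewrite mul1r -mulrA.
have E M : (n - j <= M)%N -> agree (n - j).+1 (dil b euler) (qfact (q ^+ b) M).
  by move=> le_M; apply: agree_euler.
apply: (@agree_trans _ _ _
  (cgauss (q ^+ b) n j * (qfact (q ^+ b) (n - j) * qfact (q ^+ b) (n + j).+1))).
  apply: agreeM => //; apply: agreeM; apply: E; lia.
by rewrite cgaussE //; apply/agree_sym/E; lia.
Qed.

(** Passage to the limit in the finite identities: replacing [cgauss] times the Euler product by 1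
    costs order [n - j + 1], and [F j] contributes order [j]. *)
Lemma agree_cgauss_sum b n (F : nat -> fps R) : (0 < b)%N -> (forall j, agree j (F j) 0) ->
  agree n.+1 ((\sum_(j < n.+1) cgauss (q ^+ b) n j * F j) * dil b euler) (fsum F).
Proof.
move=> b0 F0; apply: agree_trans (agree_sym (fsumP F0 (leqnn _))).
rewrite big_distrl /=; apply: agree_sum => -[j /=]; rewrite ltnS => le_jn _.
apply/agreeB0; rewrite mulrAC -[X in _ - X]mul1r -mulrBl.
have -> : n.+1 = ((n - j).+1 + j)%N by lia.
by apply: agreeM0 (F0 j); apply/agreeB0; apply: agree_cgauss.
Qed.

(* The terms of indices [j] and [-(j+1)] in the bilateral series for [phi]. *)
Definition phi_term j : fps R := (-1) ^+ j * q ^+ (j ^ 2) - (-1) ^+ j * q ^+ (j.+1 ^ 2).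
Definition phi := fsum phi_term.
Definition psi := fsum (fun j => q ^+ 'C(j.+1, 2)).
Definition jacobi_series := fsum (fun j => (-1) ^+ j * (2 * j).+1%:R * q ^+ 'C(j.+1, 2)).

Lemma leq_tri j : (j <= 'C(j.+1, 2))%N.
Proof. by elim: j => // j IHj; rewrite tri_succ; lia. Qed.

Lemma agree_cqX c N k : (N <= k)%N -> agree N (c * q ^+ k) (0 : fps R).
Proof.
by move=> le_Nk; rewrite -[X in agree X](add0n N); apply: agreeM0 => //; apply: agree_qX.
Qed.

Lemma tri_double j : (2 * 'C(j.+1, 2) = j * j.+1)%N.
Proof. by elim: j => // j IHj; rewrite tri_succ mulnDr IHj; lia. Qed.

(** The finite Jacobi product at [x = q^2], [z = -q] is [(-q)^n O_n O_(n+1)], where [O_n] is the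
    product of the first [n] factors [1 - q^(2i+1)]; moreover [O_n E_2] tends to [E_1]. *)
Lemma phi_euler : phi * dil 2 euler = euler ^+ 2.
Proof.
pose O n : fps R := \prod_(i < n) (1 - q ^+ (2 * i).+1).
have O_qfact n : O n * qfact (q ^+ 2) n = qfact q (2 * n).
  elim: n => [|n IHn]; first by rewrite /O !qfact0 big_ord0 mulr1.
  have e : (2 * n.+1 = (2 * n).+2)%N by lia.
  by rewrite /O big_ord_recr -/(O n) /= e !qfactS -IHn -exprM e; ring.
have O_euler m n : (m <= n)%N -> agree m (O n * dil 2 euler) euler.
  move=> le_mn; apply: (@agree_trans _ _ _ (O n * qfact (q ^+ 2) n)).
    by apply: agreeM => //; apply: agree_euler => //; lia.
  rewrite O_qfact -[q in qfact q]expr1; apply: agree_sym.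
  rewrite -{1}(dil1 euler).
  by apply: agree_euler => //; lia.
have phi0 j : agree j (phi_term j) 0.
  apply/agreeB0; apply: (@agree_trans _ _ _ 0); last apply: agree_sym; apply: agree_cqX; nia.
have OO n : O n * O n.+1 = \sum_(j < n.+1) cgauss (q ^+ 2) n j * phi_term j.
  have q0 : (- q) ^+ n != 0 by rewrite expf_eq0 oppr_eq0 (negPf (fq_neq0 _)) andbF.
  apply: (mulfI q0).
  transitivity ((1 - q) * \prod_(i < n) (((q ^+ 2) ^+ i.+1 - q) * (1 + (q ^+ 2) ^+ i.+1 * - q))).
    have -> : O n.+1 = (1 - q) * \prod_(i < n) (1 + (q ^+ 2) ^+ i.+1 * - q).
      rewrite /O big_ord_recl; congr (_ * _); apply: eq_bigr => i _.
      by rewrite mulrN -exprM -exprSr; congr (1 - q ^+ _); rewrite /bump /=; lia.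
    have H : (- q) ^+ n * O n = \prod_(i < n) ((q ^+ 2) ^+ i.+1 - q).
      rewrite -[n in (- q) ^+ n]card_ord -prodr_const -big_split; apply: eq_bigr => i _ /=.
      have -> : (q ^+ 2) ^+ i.+1 = q * q ^+ (2 * i).+1.
        by rewrite -exprM -exprS; congr (_ ^+ _); lia.
      by ring.
    by rewrite big_split /= -H; ring.
  rewrite finite_jacobi big_distrr; apply: eq_bigr => -[j /=]; rewrite ltnS => le_jn _.
  rewrite -exprM tri_double [_ * cgauss _ _ _]mulrC -mulrA [RHS]mulrCA; congr (_ * _).
  rewrite mulrDr /phi_term.
  have sg k : (- q) ^+ k = (-1) ^+ k * q ^+ k by exact: exprNn.
  have e1 : (-1) ^+ (n.+1 + j) = - ((-1) ^+ n * (-1) ^+ j) :> fps R.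
    by rewrite addSn exprS exprD mulN1r.
  have e2 : (-1) ^+ (n - j) = (-1) ^+ n * (-1) ^+ j :> fps R.
    exact: signr_sub.
  rewrite !sg e1 e2.
  have e3 : q ^+ (j * j.+1) * q ^+ (n.+1 + j) = q ^+ n * q ^+ (j.+1 ^ 2).
    by rewrite -!exprD; congr (_ ^+ _); lia.
  have e4 : q ^+ (j * j.+1) * q ^+ (n - j) = q ^+ n * q ^+ (j ^ 2).
    by rewrite -!exprD; congr (_ ^+ _); lia.
  by rewrite !(mulrCA (q ^+ (j * j.+1))) e3 e4; ring.
apply: agree_eq => N; apply: (@agree_trans _ _ _ (O N * O N.+1 * dil 2 euler * dil 2 euler)).
  apply: agreeM => //; apply: agree_sym; rewrite OO.
  by apply: (agreeW (leqnSn N)); apply: agree_cgauss_sum.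
rewrite expr2 (_ : _ * _ = (O N * dil 2 euler) * (O N.+1 * dil 2 euler)); last by ring.
by apply: agreeM; apply: O_euler; lia.
Qed.

(** At [x = q], [z = 1] the finite product is the square of [P n], the alternating inner sums equal
    1, and [P n] times [E_1] tends to [E_2]. *)
Lemma psi_euler : psi * euler = dil 2 euler ^+ 2.
Proof.
pose P n : fps R := \prod_(i < n) (1 + q ^+ i.+1).
have P_qfact n : P n * qfact q n = qfact (q ^+ 2) n.
  rewrite /P /qfact -big_split; apply: eq_bigr => i _ /=.
  by rewrite -exprM mulnC exprM; ring.
have P_euler n : agree n (P n * euler) (dil 2 euler).
  apply: (@agree_trans _ _ _ (P n * qfact q n)).
    rewrite -[q in qfact q]expr1 -{1}(dil1 euler).
    by apply: agreeM => //; apply: agree_euler.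
  by rewrite P_qfact; apply/agree_sym/agree_euler.
have psi0 j : agree j (q ^+ 'C(j.+1, 2)) 0 by apply: agree_qX; apply: leq_tri.
have PP n : P n ^+ 2 = \sum_(j < n.+1) cgauss (q ^+ 1) n j * q ^+ 'C(j.+1, 2).
  transitivity (\prod_(i < n) ((q ^+ i.+1 + 1) * (1 + q ^+ i.+1 * 1))).
    by rewrite /P -prodrXl; apply: eq_bigr => i _; ring.
  rewrite finite_jacobi_quot; apply: eq_bigr => j _; rewrite expr1n mul1r expr1.
  have -> : \sum_(i < (2 * j).+1) (-1) ^+ i = 1 :> fps R.
    elim: (nat_of_ord j) => [|k IHk]; first by rewrite big_ord1.
    have -> : (2 * k.+1).+1 = (2 * k).+3 by lia.
    by rewrite 2!big_ord_recr /= IHk !exprS; ring.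
  by rewrite mulr1 mulrC.
apply: agree_eq => N; apply: (@agree_trans _ _ _ (P N ^+ 2 * euler * euler)).
  apply: agreeM => //; apply: agree_sym; rewrite PP -{1}(dil1 euler).
  by apply: (agreeW (leqnSn N)); apply: agree_cgauss_sum.
rewrite expr2 (_ : _ * _ = (P N * euler) * (P N * euler)); last by ring.
by rewrite expr2; apply: agreeM.
Qed.

(** At [x = q], [z = -1] the finite product is [(-1)^n] times the square of [qfact q n], and the
    inner sums count [2 j + 1] ones. *)
Lemma euler_cube : euler ^+ 3 = jacobi_series.
Proof.
have jac0 j : agree j ((-1) ^+ j * (2 * j).+1%:R * q ^+ 'C(j.+1, 2)) 0.
  by apply: agree_cqX; apply: leq_tri.
have QQ n : qfact q n ^+ 2 =
    \sum_(j < n.+1) cgauss (q ^+ 1) n j * ((-1) ^+ j * (2 * j).+1%:R * q ^+ 'C(j.+1, 2)).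
  have s0 : (-1) ^+ n != 0 :> fps R by rewrite signr_eq0.
  apply: (mulfI s0).
  transitivity (\prod_(i < n) ((q ^+ i.+1 + -1) * (1 + q ^+ i.+1 * -1))).
    rewrite /qfact -prodrXl -[n in _ ^+ n]card_ord -prodr_const -big_split.
    by apply: eq_bigr => i _ /=; ring.
  rewrite finite_jacobi_quot big_distrr; apply: eq_bigr => -[j /=]; rewrite ltnS => le_jn _.
  have -> : \sum_(i < (2 * j).+1) (- -1) ^+ i = (2 * j).+1%:R :> fps R.
    by under eq_bigr do rewrite opprK expr1n; rewrite sumr_const card_ord.
  by rewrite expr1 signr_sub //; ring.
apply: agree_eq => N; apply: (@agree_trans _ _ _ (qfact q N ^+ 2 * euler)); last first.
  rewrite QQ -{1}(dil1 euler).
  by apply: (agreeW (leqnSn N)); apply: agree_cgauss_sum.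
rewrite exprSr; apply: agreeM => //; rewrite !expr2 -{1 2}(dil1 euler).
by apply: agreeM; rewrite -[q]expr1; apply: agree_euler.
Qed.

End ThetaProducts.

(** * Theta series and Gaussian integers *)

Section CountingSeries.
Variable R : idomainType.

Section Generic.
Variable T : eqType.
Implicit Types (w : T -> int) (N : T -> nat) (P : pred T) (s : nat -> seq T).

(** Here [w] weighs a point and [N] is its norm; under [fibres N P s] this is the weighted theta
    series of the set [P]. *)
Definition gen_series w s : fps R := Fps (fun n => (\sum_(u <- s n) w u)%:~R).
Definition fibres N P s :=
  forall n, uniq (s n) /\ forall u, (u \in s n) = P u && (N u == n).

Lemma eq_gen_series w N P P' s s' : fibres N P s -> fibres N P' s' -> P =1 P' ->
  gen_series w s = gen_series w s'.
Proof.
move=> fib fib' eqP; apply: fpsP => n; congr (_%:~R); apply: perm_big.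
have [us ms] := fib n; have [us' ms'] := fib' n.
by apply: uniq_perm => // u; rewrite ms ms' eqP.
Qed.

Lemma homog_gen_series i w N P s : fibres N P s -> (forall u, P u -> N u = i %[mod 5]) ->
  homog i (gen_series w s).
Proof.
move=> fib Pi n ni; rewrite /= big_seq big_pred0 ?mulr0z // => u.
rewrite (fib n).2; apply: contraNF ni => /andP [/Pi <- /eqP ->]; exact: eqxx.
Qed.

End Generic.

(** The map [h] is a weight-preserving bijection between the two point sets that multiplies norms by
    [m]. *)
Lemma gen_series_dil (T1 T2 : eqType) m (h : T1 -> T2) w1 w2 N1 N2 P1 P2 s1 s2 :
  (0 < m)%N -> fibres N1 P1 s1 -> fibres N2 P2 s2 -> injective h ->
  (forall u, P1 u -> P2 (h u)) -> (forall v, P2 v -> exists2 u, P1 u & v = h u) ->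
  (forall u, N2 (h u) = (m * N1 u)%N) -> (forall u, w2 (h u) = w1 u) ->
  gen_series w2 s2 = dil m (gen_series w1 s1).
Proof.
move=> m0 fib1 fib2 injh Ph Psur Nh wh; apply: fpsP => n /=.
case: ifP => [/dvdnP [k ->]|ndiv]; last first.
  rewrite big_seq big_pred0 ?mulr0z // => v; apply: contraFF ndiv.
  by rewrite (fib2 n).2 => /andP [/Psur [u _ ->] /eqP <-]; rewrite Nh dvdn_mulr.
rewrite mulnK //; congr (_%:~R).
under [RHS]eq_bigr do rewrite -wh.
rewrite -(big_map h xpredT w2); apply: perm_big; apply: uniq_perm.
- exact: (fib2 _).1.
- by rewrite map_inj_uniq // (fib1 _).1.
move=> v; rewrite (fib2 _).2; apply/andP/mapP => [[Pv /eqP Nv]|[u]].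
  have [u Pu vE] := Psur v Pv; exists u => //; rewrite (fib1 _).2 Pu /=.
  by move: Nv; rewrite vE Nh mulnC => /eqP; rewrite eqn_pmul2r.
by rewrite (fib1 _).2 => /andP [Pu /eqP Nu] ->; rewrite Ph // Nh Nu mulnC.
Qed.

(** The integers from [-(n+1)] to [n]. Since [Negz j] is [-(j+1)], they come in the same pairs [j],
    [-(j+1)] as the folded theta series. *)
Definition int_ball n : seq int :=
  [seq Posz j | j <- iota 0 n.+1] ++ [seq Negz j | j <- iota 0 n.+1].

Lemma int_ball_uniq n : uniq (int_ball n).
Proof.
rewrite cat_uniq !map_inj_uniq ?iota_uniq ?andbT; try by move=> ? ? [].
by apply/hasPn => x /mapP [j _ ->]; apply/mapP => -[].
Qed.

Lemma int_ball_sqr n x : (`|x| ^ 2 <= n)%N -> x \in int_ball n.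
Proof.
case: x => j le_jn; rewrite mem_cat; apply/orP; [left|right];
  by apply: map_f; rewrite mem_iota /=; move: le_jn; rewrite ?absz_nat ?NegzE; nia.
Qed.

Definition sqnorm1 (x : int) := (`|x| ^ 2)%N.
Definition sqnorm2 (u : int * int) := (`|u.1| ^ 2 + `|u.2| ^ 2)%N.
Definition pts1 (P : pred int) n := [seq x <- int_ball n | P x && (sqnorm1 x == n)].
Definition pts2 (P : pred (int * int)) n :=
  [seq u <- [seq (x, y) | x <- int_ball n, y <- int_ball n] | P u && (sqnorm2 u == n)].

Lemma pts1P P : fibres sqnorm1 P (pts1 P).
Proof.
move=> n; split=> [|x]; first by rewrite filter_uniq ?int_ball_uniq.
rewrite mem_filter; case: eqP => [<-|]; rewrite ?andbF // int_ball_sqr ?andbT //.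
Qed.

Lemma pts2P P : fibres sqnorm2 P (pts2 P).
Proof.
move=> n; split=> [|[x y]].
  by rewrite filter_uniq // allpairs_uniq ?int_ball_uniq // => -[? ?] [? ?] _ _ [-> ->].
rewrite mem_filter; case: eqP => [<-|]; rewrite ?andbF // andbT.
apply: andb_idr => _; apply/allpairsP; exists (x, y).
by split=> //; apply: int_ball_sqr; rewrite /sqnorm2 /=; lia.
Qed.

Variable w : int -> int.
Definition theta1 P := gen_series w (pts1 P).
Definition theta2 P := gen_series (fun u : int * int => w u.1 * w u.2) (pts2 P).

Lemma theta1M (P Q : pred int) : theta1 P * theta1 Q = theta2 (fun u => P u.1 && Q u.2).
Proof.
have wid N n S : (n <= N)%N ->
    \sum_(x <- pts1 S n) w x = \sum_(x <- int_ball N | S x && (sqnorm1 x == n)) w x.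
  move=> le_nN; rewrite -[RHS]big_filter; apply: perm_big; apply: uniq_perm.
  - exact: (pts1P S n).1.
  - by rewrite filter_uniq ?int_ball_uniq.
  move=> x; rewrite (pts1P S n).2 mem_filter [RHS]andb_idr // => /andP [_ /eqP Nx].
  by apply: int_ball_sqr; rewrite -/(sqnorm1 x) Nx.
apply: fpsP => n; rewrite fcoefM /=.
under eq_bigr => i _.
  rewrite -rmorphM /= (wid n) ?(wid n (n - i)%N) ?leq_subr //; last by rewrite -ltnS.
  over.
rewrite -rmorph_sum /=; congr (_%:~R).
rewrite /pts2 [RHS]big_filter [RHS]big_mkcond big_allpairs_dep /=.
under eq_bigr do rewrite big_distrlr.
rewrite (eq_bigr (fun i : 'I_n.+1 => \sum_(x <- int_ball n) \sum_(y <- int_ball n)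
   (if (P x && (sqnorm1 x == i)) && (Q y && (sqnorm1 y == n - i)%N)
    then w x * w y else 0))); last first.
  move=> i _; rewrite big_mkcond; apply: eq_bigr => x _; rewrite big_mkcond /=.
  by case: (P x && _) => //=; rewrite big1.
rewrite exchange_big; apply: eq_bigr => x _; rewrite exchange_big; apply: eq_bigr => y _ /=.
case: (P x) => /=; last by rewrite big1.
case: (Q y) => /=; last by rewrite big1 // => i _; rewrite andbF.
have [E|NE] := eqVneq (sqnorm2 (x, y)) n.
  have lt_n : (sqnorm1 x < n.+1)%N by rewrite ltnS -E leq_addr.
  rewrite (bigD1 (Ordinal lt_n)) //= eqxx -{1}E addKn eqxx /= big1 ?addr0 // => i.
  by rewrite -val_eqE /= eq_sym => /negPf ->.
rewrite big1 // => i _; case: ifP => // /andP [/eqP xi /eqP yi]; case/negP: NE.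
by rewrite /sqnorm2 /= -/(sqnorm1 x) -/(sqnorm1 y) xi yi subnKC // -ltnS.
Qed.

Definition res (x : int) : nat := `|(x %% 5)%Z|.

Lemma theta1_split : theta1 xpredT = \sum_(r < 5) theta1 (fun x => res x == r).
Proof.
apply: fpsP => n; rewrite fcoef_sum /= -rmorph_sum /=; congr (_%:~R).
rewrite /pts1 big_filter.
under [RHS]eq_bigr do rewrite big_filter.
rewrite (partition_big (fun x => inord (res x) : 'I_5) xpredT) //=.
apply: eq_bigr => r _; apply: eq_bigl => x; rewrite andbC; congr (_ && _).
by rewrite -val_eqE /= inordK // /res; lia.
Qed.

Lemma theta2_split P : theta2 P = \sum_(r < 5) theta2 (fun u => P u && (res u.2 == r)).
Proof.
apply: fpsP => n; rewrite fcoef_sum /= -rmorph_sum /=; congr (_%:~R).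
rewrite /pts2 big_filter.
under [RHS]eq_bigr do rewrite big_filter.
rewrite (partition_big (fun u => inord (res u.2) : 'I_5) xpredT) //=.
apply: eq_bigr => r _; apply: eq_bigl => x; rewrite andbAC; congr (_ && _ && _).
by rewrite -val_eqE /= inordK // /res; lia.
Qed.

(** * Five-dissection of a weighted theta series *)

Hypotheses (wN : forall x, w (- x) = w x) (w5 : forall x, w (5 * x) = w x)
  (wrot : forall x y, w (2 * x - y) * w (x + 2 * y) = w x * w y).

Let c (r : nat) := theta1 (fun x => res x == r).
Let theta := theta1 xpredT.

(** Multiplication by 5 maps the integers onto the multiples of 5 and multiplies norms by 25. *)
Lemma theta_class0 : c 0 = dil 25 theta.
Proof.
apply: (@gen_series_dil _ _ _ (fun x => 5 * x) _ _ _ _ _ _ _ _ _ (pts1P _) (pts1P _)) => //.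
- by move=> x y; lia.
- by move=> x _; rewrite /res; lia.
- by move=> x; rewrite /res => Hx; exists (x %/ 5)%Z => //; lia.
- by move=> x; rewrite /sqnorm1 abszM; lia.
Qed.

Lemma theta_classN r : (0 < r < 5)%N -> c (5 - r)%N = c r.
Proof.
move=> Hr; rewrite /c -[RHS](dil1 (theta1 _)).
apply: (@gen_series_dil _ _ _ (fun x => - x) _ _ _ _ _ _ _ _ _ (pts1P _) (pts1P _)) => //.
- exact: oppr_inj.
- by move=> x; rewrite /res => /eqP; lia.
- by move=> x; rewrite /res => Hx; exists (- x); [lia | rewrite opprK].
- by move=> x; rewrite /sqnorm1 abszN mul1n.
Qed.

(* Multiplication by [2 + i] maps [Z[i]] onto the [x + i y] with [x = 2 y] mod 5. *)
Lemma theta_sqr : dil 5 theta ^+ 2 = theta2 (fun u => res u.1 == (2 * res u.2) %% 5)%N.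
Proof.
rewrite -rmorphXn expr2 theta1M /=; symmetry.
apply: (@gen_series_dil _ _ _ (fun u => (2 * u.1 - u.2, u.1 + 2 * u.2))
  _ _ _ _ _ _ _ _ _ (pts2P _) (pts2P _)) => //.
- by move=> [x y] [x' y'] /= []; move=> H1 H2; congr pair; lia.
- by move=> [x y] _ /=; rewrite /res; lia.
- move=> [x y] /= Hxy; exists (y + 2 * ((x - 2 * y) %/ 5)%Z, - ((x - 2 * y) %/ 5)%Z) => //=.
  by move: Hxy; rewrite /res => Hxy; congr pair; lia.
- by move=> [x y]; rewrite /sqnorm2 /=; nia.
- by move=> [x y] /=; apply: wrot.
Qed.

(** Squares are 0, 1 or 4 modulo 5. By [theta_classN] component 1 is [2 c 1] and component 4 is
    [2 c 2], while the pairs with [x = 2 y] modulo 5 contribute [c 0 ^+ 2 + 4 c 1 c 2] to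
    [theta_sqr]. *)
Lemma theta_comps : [/\ comp 0 theta = dil 25 theta, comp 2 theta = 0, comp 3 theta = 0
  & comp 1 theta * comp 4 theta = dil 5 theta ^+ 2 - dil 25 theta ^+ 2].
Proof.
have sp : theta = c 0 + c 1 + c 2 + c 3 + c 4.
  by rewrite /theta theta1_split !big_ord_recl big_ord0 /= !addrA addr0.
have hc r : (r < 5)%N -> homog (r ^ 2) (c r).
  move=> r5; apply: homog_gen_series (pts1P _) _ => x /eqP; rewrite /res /sqnorm1 => Hx.
  have : x = r %[mod 5]%Z by lia.
  move=> H; have : (x ^+ 2 = (r : int) ^+ 2 %[mod 5])%Z by rewrite -modzXm H modzXm.
  move=> H2; lia.
have c3 : c 3 = c 2 by apply: (@theta_classN 2).
have c4 : c 4 = c 1 by apply: (@theta_classN 1).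
have C i : comp i theta = comp i (c 0) + comp i (c 1) + comp i (c 2) + comp i (c 3) + comp i (c 4).
  by rewrite {1}sp !raddfD.
have K i r : (r < 5)%N -> comp i (c r) = if (r ^ 2 == i %[mod 5])%N then c r else 0.
  move=> /hc h; case: eqP => [e|/eqP ne]; last exact: homog_comp0 h ne.
  by apply: homog_comp => n; rewrite -e; apply: h.
rewrite !C !K //= c3 c4.
rewrite !(addr0, add0r); split=> //; first exact: theta_class0.
rewrite theta_sqr theta2_split -theta_class0.
have E (r r' : nat) : (r < 5)%N -> r' = ((2 * r) %% 5)%N ->
   theta2 (fun u => (res u.1 == (2 * res u.2) %% 5)%N && (res u.2 == r)) = c r' * c r.
  move=> r5 ->; rewrite theta1M; apply: eq_gen_series (pts2P _) (pts2P _) _ => u /=.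
  by rewrite andbC [RHS]andbC; case: eqP => // ->.
rewrite !big_ord_recl big_ord0 /=.
by rewrite (E 0 0) // (E 1 2)%N // (E 2 4)%N // (E 3 1)%N // (E 4 3)%N // c3 c4; ring.
Qed.

Lemma fcoefMz (f : fps R) z n : coef (f *~ z) n = coef f n *~ z.
Proof. by case: z => m; rewrite ?NegzE ?mulrNz ?fcoefN -!pmulrn fcoefMn. Qed.

Lemma thetaE : theta = fsum (fun j => fq ^+ (j ^ 2) *~ w j + fq ^+ (j.+1 ^ 2) *~ w j.+1).
Proof.
have iotaE n : iota 0 n = index_iota 0 n by rewrite /index_iota subn0.
apply: fpsP => n; rewrite [RHS]/= fcoef_sum [LHS]/=.
rewrite /pts1 big_filter /int_ball iotaE big_cat !big_map.
rewrite rmorphD !rmorph_sum !(big_mkcond (fun j => sqnorm1 _ == n)) !big_mkord -big_split.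
apply: eq_bigr => j _ /=.
rewrite !fcoefMz !fcoefqX NegzE wN /sqnorm1 absz_nat -![n == _]eq_sym.
by congr (_ + _); case: eqP; rewrite ?mulr0z ?mul0rz.
Qed.

End CountingSeries.

(** * Five-dissections of [phi] and [psi] *)

Section PhiPsi.
Variable R : idomainType.
Notation q := (fq : fps R).

Lemma fsum_eq (F : nat -> fps R) f (k : nat -> nat) : (forall j, agree j (F j) 0) -> 
  (forall n, n <= k n)%N -> (forall n, agree n f (\sum_(j < k n) F j)) -> f = fsum F.
Proof.
move=> F0 kn fF; apply: agree_eq => N; apply: agree_trans (fF N) _.
by apply/agree_sym/fsumP.
Qed.

(** The weight is [(-1)^x]; it is compatible with multiplication by [2 + i] because
    [(2x - y) + (x + 2y)] has the parity of [x + y]. *)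
Lemma phi_comps : [/\ comp 0 (phi R) = dil 25 (phi R), comp 2 (phi R) = 0, comp 3 (phi R) = 0
  & comp 1 (phi R) * comp 4 (phi R) = dil 5 (phi R) ^+ 2 - dil 25 (phi R) ^+ 2].
Proof.
pose w (x : int) : int := (-1) ^+ `|x|.
have wodd x : w x = (-1) ^+ odd `|x| by rewrite signr_odd.
have -> : phi R = theta1 R w xpredT.
  rewrite thetaE => [|x]; last by rewrite /w abszN.
  congr fsum; apply/boolp.funext => j; rewrite /phi_term /w !absz_nat.
  have H (f : fps R) k : f *~ ((-1) ^+ k) = (-1) ^+ k * f.
    by rewrite -mulrzl rmorphXn /= rmorphN1.
  by rewrite !H exprS mulN1r mulNr.
apply: theta_comps => [x|x|x y]; rewrite !wodd ?abszN //.
  by congr (_ ^+ nat_of_bool _); lia.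
by rewrite -!signr_addb; congr (_ ^+ nat_of_bool _); lia.
Qed.

Lemma comp_q_dil8 i (f : fps R) : comp (8 * i).+1 (q * dil 8 f) = q * dil 8 (comp i f).
Proof.
apply: fpsP => n; rewrite -[LHS]/(if n == (8 * i).+1 %[mod 5] then coef (q * dil 8 f) n else 0).
rewrite !fcoefqM; case: n => [|n] /=; first by case: ifP.
case: (boolP (8 %| n)%N) => [/dvdnP [k ->]|_]; last by case: ifP.
by rewrite mulnK //; congr (if _ then _ else _); lia.
Qed.

Hypothesis R2 : 2 != 0 :> R.

(** Weighting by the indicator of odd integers gives [2 q psi(q^8)], since [(2k+1)^2] is 1 plus 8
    times a triangular number. Class [i] of [psi] thus becomes class [8 i + 1] of this theta
    series. *)
Lemma psi_comps :
  [/\ comp 3 (psi R) = q ^+ 3 * dil 25 (psi R), comp 2 (psi R) = 0, comp 4 (psi R) = 0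
  & comp 0 (psi R) * comp 1 (psi R) = q * (dil 5 (psi R) ^+ 2 - q ^+ 5 * dil 25 (psi R) ^+ 2)].
Proof.
pose w (x : int) : int := odd `|x|.
pose theta := theta1 R w xpredT.
have thE : theta = (q * dil 8 (psi R)) *+ 2.
  rewrite /theta thetaE => [|x]; last by rewrite /w abszN.
  (* The folded terms of indices [2n] and [2n+1] each contribute [q^((2n+1)^2)], so [2n] of them
     match [n] terms of [psi], taken twice. *)
  symmetry; apply: (@fsum_eq _ _ (fun n => 2 * n)%N) => [j|n|n].
  - rewrite -[X in agree _ _ X]addr0 => i lt_ij; rewrite !fcoefD !fcoefMz !fcoefqX.
    have sq k : (k <= k ^ 2)%N by case: k => // k; rewrite expnS expn1 leq_pmulr.
    by rewrite !ltn_eqF ?mul0rz ?(leq_trans _ (sq _)) // ltnW.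
  - lia.
  have -> : \sum_(j < 2 * n) (q ^+ (j ^ 2) *~ w j + q ^+ (j.+1 ^ 2) *~ w j.+1)
     = (q * \sum_(j < n) dil 8 (q ^+ 'C(j.+1, 2))) *+ 2.
    elim: n => [|n IHn]; first by rewrite !big_ord0 mulr0 mul0rn.
    have -> : (2 * n.+1 = (2 * n).+2)%N by lia.
    rewrite 2!big_ord_recr /= {}IHn [in RHS]big_ord_recr /=.
    have odds : [/\ w (2 * n)%N = 0, w (2 * n).+1 = 1 & w (2 * n).+2 = 0].
      by rewrite /w !absz_nat /= oddM.
    case: odds => -> -> ->; rewrite !mulr0z !mulr1z.
    rewrite rmorphXn /= dil_fq // -exprM.
    have -> : q ^+ ((2 * n).+1 ^ 2) = q * q ^+ (8 * 'C(n.+1, 2)).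
      by rewrite -exprS; congr (_ ^+ _); have := tri_double n; lia.
    by ring.
  rewrite !mulr2n => i lt_in; rewrite !fcoefD; congr (_ + _); move: i lt_in;
  rewrite -/(agree n (q * dil 8 (psi R)) (q * \sum_(j < n) dil 8 (q ^+ 'C(j.+1, 2))));
  apply: agreeM => //; rewrite -rmorph_sum; apply: agree_dil => //; apply: fsumP => // j;
  exact: agree_qX (leq_tri j).
have R2' : (2 : fps R) != 0.
  by apply: contra R2 => /eqP /(congr1 (fun f => coef f 0)) /= /eqP.
have Q0 : q != 0 := fq_neq0 R.
have thcomp i j : i = (8 * j).+1 %[mod 5] -> comp i theta = 2 * (q * dil 8 (comp j (psi R))).
  move=> ij; have -> : comp i theta = comp (8 * j).+1 theta by apply: fpsP => n; rewrite /= ij.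
  by rewrite thE raddfMn /= comp_q_dil8 mulr_natl.
have inj2 (f g : fps R) : f *+ 2 = g *+ 2 -> f = g.
  by rewrite -mulr_natl -[g *+ 2]mulr_natl; apply: mulfI.
have injq (f g : fps R) : q * dil 8 f = q * dil 8 g -> f = g.
  by move/(mulfI Q0)/dil_inj; apply.
have : [/\ comp 0 theta = dil 25 theta, comp 2 theta = 0, comp 3 theta = 0
  & comp 1 theta * comp 4 theta = dil 5 theta ^+ 2 - dil 25 theta ^+ 2].
  apply: theta_comps => [x|x|x y]; rewrite /w ?abszN //.
    by congr (Posz (nat_of_bool _)); lia.
  by rewrite -!PoszM !mulnb; congr (Posz (nat_of_bool _)); lia.
clearbody theta.
rewrite (@thcomp 0 3%N) // (@thcomp 2 2%N) // (@thcomp 3 4%N) //.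
rewrite (@thcomp 1 0%N) // (@thcomp 4 1%N) //.
have D d : (0 < d)%N -> dil d theta = 2 * (q ^+ d * dil 8 (dil d (psi R))).
  by move=> d0; rewrite thE rmorphMn rmorphM /= mulr_natl dil_fq // !dil_dil // mulnC.
rewrite (D 25%N) // (D 5%N) // => -[H0 H2 H3 H4]; split.
- apply: injq; apply: (mulfI R2'); rewrite H0 rmorphM rmorphXn /= dil_fq //.
  ring.
- by apply: injq; apply: (mulfI R2'); rewrite H2 raddf0 !mulr0.
- by apply: injq; apply: (mulfI R2'); rewrite H3 raddf0 !mulr0.
apply: injq; apply: (mulfI R2'); apply: (mulfI R2'); apply: (mulfI Q0).
transitivity (2 * (q * dil 8 (comp 0 (psi R))) * (2 * (q * dil 8 (comp 1 (psi R))))).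
  by rewrite rmorphM /=; ring.
rewrite H4 rmorphM /= rmorphB /= rmorphXn /= [dil 8 (q ^+ 5 * _)]rmorphM /= !rmorphXn /= dil_fq //.
ring.
Qed.

End PhiPsi.

(** * Elimination *)

(* In the application [a = al + be], [c = ga + de], [2 d = al de + be ga],
   [2 e = al ga + be de], [2 P = al be] and [2 V = ga de]. *)
Section Quintic.
Variables (K : comNzRingType) (P V a c d e : K).
Hypotheses
  (aa : a * a = 4 * P - 2 * P * c - 2 * P * e) (ac : a * c = 2 * d + 2 * e)
  (ad : a * d = 2 - 2 * P + P * c) (ae : a * e = P * c - a - 2 * d)
  (cc : c * c = 4 * V - 2 * V * a - 2 * V * d)
  (cd : c * d = V * a - c - 2 * e) (ce : c * e = V * a + 2 - 2 * V) (PV : P * V = -1).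

(** The hypotheses make the span of [1, a, c, d, e] over polynomials in [P] and [V] stable under
    multiplication by [a] and [c]; these are coordinates in it. *)
Definition comb5 x0 x1 x2 x3 x4 := x0 + x1 * a + x2 * c + x3 * d + x4 * e.

Lemma mul1c_comb5 x0 x1 x2 x3 x4 : (1 + c) * comb5 x0 x1 x2 x3 x4 =
  comb5 (x0 + 4 * V * x2 + (2 - 2 * V) * x4) (x1 - 2 * V * x2 + V * x3 + V * x4)
   (x2 + x0 - x3) (x3 - 2 * V * x2 + 2 * x1) (x4 + 2 * x1 - 2 * x3).
Proof.
have -> : (1 + c) * comb5 x0 x1 x2 x3 x4 = comb5 x0 x1 x2 x3 x4 + x0 * c + x1 * (a * c)
  + x2 * (c * c) + x3 * (c * d) + x4 * (c * e) by rewrite /comb5; ring.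
by rewrite ac cc cd ce /comb5; ring.
Qed.

Lemma mul1a_comb5 x0 x1 x2 x3 x4 : (1 + a) * comb5 x0 x1 x2 x3 x4 =
  comb5 (x0 + 4 * P * x1 + (2 - 2 * P) * x3) (x1 + x0 - x4)
     (x2 - 2 * P * x1 + P * x3 + P * x4) (x3 + 2 * x2 - 2 * x4) (x4 - 2 * P * x1 + 2 * x2).
Proof.
have -> : (1 + a) * comb5 x0 x1 x2 x3 x4 = comb5 x0 x1 x2 x3 x4 + x0 * a + x1 * (a * a)
  + x2 * (a * c) + x3 * (a * d) + x4 * (a * e) by rewrite /comb5; ring.
by rewrite ac aa ad ae /comb5; ring.
Qed.

Let W := (1 + a) * (1 + c).
Let tau := (1 + 2 * P) * (1 + 2 * V).

(** The first coordinates of the powers of [W] matter twice: in the quintic, and later as their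
    parts with exponents divisible by 5. *)
Lemma norm_pow1 : W = comb5 1 1 1 2 2.
Proof.
have -> : W = (1 + a) * ((1 + c) * comb5 1 0 0 0 0) by rewrite /W /comb5; ring.
rewrite mul1c_comb5 mul1a_comb5; congr comb5; ring.
Qed.

Lemma norm_pow2 : W ^+ 2 =
  comb5 (1 - 4 * P - 4 * V) (6 + 2 * V) (6 + 2 * P) (4 - 2 * V) (4 - 2 * P).
Proof.
rewrite exprS expr1 {2}norm_pow1 -mulrA mul1c_comb5 mul1a_comb5; congr comb5; ring: PV.
Qed.

Lemma norm_pow3 : W ^+ 3 =
  comb5 25 (1 - 6 * P + 2 * V - 2 * V ^+ 2) (1 - 6 * V + 2 * P - 2 * P ^+ 2)
  (10 - 30 * V) (10 - 30 * P).
Proof.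
rewrite exprS norm_pow2 -mulrA mul1c_comb5 mul1a_comb5; congr comb5; ring: PV.
Qed.

Lemma norm_pow4 : W ^+ 4 = comb5 (-127 + 24 * P + 24 * V - 8 * P ^+ 2 - 8 * V ^+ 2)
  (20 - 20 * P - 60 * V - 40 * V ^+ 2) (20 - 20 * V - 60 * P - 40 * P ^+ 2) 
  (64 + 72 * P - 108 * V - 4 * P ^+ 2 + 16 * V ^+ 2)
  (64 + 72 * V - 108 * P - 4 * V ^+ 2 + 16 * P ^+ 2).
Proof.
rewrite exprS norm_pow3 -mulrA mul1c_comb5 mul1a_comb5; congr comb5; ring: PV.
Qed.

(** In the coordinates above, all five vanish once [tau] is reduced to [2 P + 2 V - 3] by
    [P V = -1]. *)
Lemma norm_quintic : W ^+ 5 - 5 * W ^+ 4 + (5 * tau + 25) * W ^+ 3 - (25 * tau + 125) * W ^+ 2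
  + (15 * tau ^+ 2 + 125 * tau + 625) * W - tau ^+ 3 = 0.
Proof.
have -> : tau = 2 * P + 2 * V - 3 by rewrite /tau; ring: PV.
rewrite exprS {1}norm_pow4 -[W in W * comb5 _ _ _ _ _]/((1 + a) * (1 + c)) -mulrA.
rewrite mul1c_comb5 mul1a_comb5 norm_pow4 norm_pow3 norm_pow2 norm_pow1 /comb5; ring: PV.
Qed.
End Quintic.

(** * Multiplication table of the dissection terms *)

Section Dissection.
Variables (K : fieldType) (al be ga de : K).
Hypotheses (c2 : 2 != 0 :> K) (d0 : de != 0).
Hypotheses (R1 : 2 * ga + al * de ^+ 2 + 2 * be * de = 0)
 (R2 : 2 * de + be * ga ^+ 2 + 2 * al * ga = 0)
 (R3 : 2 * al + be ^+ 2 * de + 2 * be * ga = 0)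
 (R4 : 2 * be + al ^+ 2 * ga + 2 * al * de = 0).
Let p := al * be.
Let v := ga * de.

(** With [Ri] denoting left-hand sides, [v (be R1 - 2 R3) + 2 de R2] equals [(p v + 4) de^2], and
    [de] is nonzero. *)
Lemma invariants_eq : p * v = -4.
Proof.
have : (p * v + 4) * de ^+ 2 = 0.
  transitivity (v * (be * (2 * ga + al * de ^+ 2 + 2 * be * de)
     - 2 * (2 * al + be ^+ 2 * de + 2 * be * ga))
     + 2 * de * (2 * de + be * ga ^+ 2 + 2 * al * ga)).
    rewrite /p /v; ring.
  by rewrite R1 R2 R3; ring.
by move/eqP; rewrite mulf_eq0 expf_eq0 (negPf d0) /= orbF addr_eq0 => /eqP.
Qed.

(** The relations give the linear system [2 X + v Y = 16], [p X + 2 Y = 16], whose determinant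
    [4 - p v] is 8. *)
Lemma cross_terms :
  al * ga ^+ 2 + be * de ^+ 2 = 4 - 2 * v /\ al ^+ 2 * de + be ^+ 2 * ga = 4 - 2 * p.
Proof.
set X := al * _ + _; set Y := al ^+ 2 * _ + _.
have HX : 2 * X + v * Y = 16.
  transitivity (al * ga * (2 * ga + al * de ^+ 2 + 2 * be * de)
    + be * de * (2 * de + be * ga ^+ 2 + 2 * al * ga) - 4 * (p * v)).
    rewrite /X /Y /p /v; ring.
  rewrite R1 R2 invariants_eq; ring.
have HY : 2 * Y + p * X = 16.
  transitivity (al * de * (2 * al + be ^+ 2 * de + 2 * be * ga)
    + be * ga * (2 * be + al ^+ 2 * ga + 2 * al * de) - 4 * (p * v)).
    rewrite /X /Y /p /v; ring.
  rewrite R3 R4 invariants_eq; ring.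
have c8 : 8 != 0 :> K by rewrite (_ : 8 = 2 ^+ 3) ?expf_neq0 //; ring.
split; apply: (mulfI c8).
  transitivity (2 * (2 * X + v * Y) - v * (2 * Y + p * X) + (p * v + 4) * X); first by ring.
  rewrite HX HY invariants_eq; ring.
transitivity (2 * (2 * Y + p * X) - p * (2 * X + v * Y) + (p * v + 4) * Y); first by ring.
rewrite HX HY invariants_eq; ring.
Qed.

Let P := p / 2.
Let V := v / 2.
Let a := al + be.
Let c := ga + de.
Let d := (al * de + be * ga) / 2.
Let e := (al * ga + be * de) / 2.

(** These are the hypotheses of the quintic, obtained from [R1] to [R4], the cross terms and
    [p v = -4]. *)
Lemma mult_table : [/\ a * a = 4 * P - 2 * P * c - 2 * P * e, a * c = 2 * d + 2 * e,
   a * d = 2 - 2 * P + P * c & a * e = P * c - a - 2 * d] /\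
  [/\ c * c = 4 * V - 2 * V * a - 2 * V * d,
  c * d = V * a - c - 2 * e, c * e = V * a + 2 - 2 * V & P * V = -1].
Proof.
have [X Y] := cross_terms; do 2!split.
- transitivity (2 * p + (al * (2 * al + be ^+ 2 * de + 2 * be * ga)
     + be * (2 * be + al ^+ 2 * ga + 2 * al * de)) / 2 - p * c - p * e).
    by rewrite /a /c /e /p; field.
  by rewrite R3 R4 /P; field.
- by rewrite /a /c /d /e; field.
- transitivity ((al ^+ 2 * de + be ^+ 2 * ga + p * c) / 2); first by rewrite /a /d /p /c; field.
  by rewrite Y /P; field.
- transitivity ((2 * al + be ^+ 2 * de + 2 * be * ga + (2 * be + al ^+ 2 * ga + 2 * al * de)
    + p * c) / 2 - a - 2 * d); first by rewrite /a /e /d /p /c; field.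
  by rewrite R3 R4 /P; field.
- transitivity (2 * v + (ga * (2 * ga + al * de ^+ 2 + 2 * be * de)
    + de * (2 * de + be * ga ^+ 2 + 2 * al * ga)) / 2 - v * a - v * d).
    by rewrite /c /a /d /v; field.
  by rewrite R1 R2 /V; field.
- transitivity ((2 * ga + al * de ^+ 2 + 2 * be * de + (2 * de + be * ga ^+ 2 + 2 * al * ga)
    + v * a) / 2 - c - 2 * e); first by rewrite /a /e /d /v /c; field.
  by rewrite R1 R2 /V; field.
- transitivity ((al * ga ^+ 2 + be * de ^+ 2 + v * a) / 2); first by rewrite /c /e /v /a; field.
  by rewrite X /V; field.
transitivity (p * v / 4).
  by rewrite /P /V; field; rewrite c2 (_ : 4 = 2 ^+ 2) ?expf_neq0 //; ring.
by rewrite invariants_eq mulNr divff // (_ : 4 = 2 ^+ 2) ?expf_neq0 //; ring.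
Qed.
End Dissection.

(* The coefficients of [Z^4], [-Z^3] and [Z^2] in the quintic equation. *)
Section ModularCoefficients.
Variables (A : comNzRingType) (x : A).
Definition qcoef1 := 15 * x + 125 * x ^+ 2 + 625 * x ^+ 3.
Definition qcoef2 := 25 * x ^+ 2 + 125 * x ^+ 3.
Definition qcoef3 := 5 * x ^+ 2 + 25 * x ^+ 3.
End ModularCoefficients.

(** * The quintic rewritten for the inverses of [W] and [tau] *)

Section Reciprocal.
Variables (K : fieldType) (w t z T : K).
Hypotheses (wz : w * z = 1) (tT : t * T = 1)
  (eqw : w ^+ 5 - 5 * w ^+ 4 + (5 * t + 25) * w ^+ 3 - (25 * t + 125) * w ^+ 2
    + (15 * t ^+ 2 + 125 * t + 625) * w - t ^+ 3 = 0).

Lemma inv_neq0 (x y : K) : x * y = 1 -> x != 0.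
Proof. by apply: contra_eq_neq => ->; rewrite mul0r eq_sym oner_eq0. Qed.

Lemma reciprocal_eq :
  z ^+ 5 = qcoef1 T * z ^+ 4 - qcoef2 T * z ^+ 3 + qcoef3 T * z ^+ 2 - 5 * T ^+ 3 * z + T ^+ 3.
Proof.
have [w0 t0] := (inv_neq0 wz, inv_neq0 tT).
have -> : z = w^-1 by rewrite -[z](mulKf w0) wz mulr1.
have -> : T = t^-1 by rewrite -[T](mulKf t0) tT mulr1.
apply/subr0_eq; rewrite -[RHS](mulr0 (- w ^- 5 / t ^+ 3)) -eqw /qcoef1 /qcoef2 /qcoef3.
by field; rewrite w0 t0.
Qed.

(** The quintic divided by [z^4], [z^3], [z^2] and [z], with negative powers of [z] written as
    powers of [w]. It supplies the initial values of the recurrence for [U(Z^k)]. *)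
Lemma reciprocal_eq_low :
  [/\ z = qcoef1 T * 1 + (- qcoef2 T) * w + qcoef3 T * w ^+ 2
        + (- (5 * T ^+ 3)) * w ^+ 3 + T ^+ 3 * w ^+ 4,
      z ^+ 2 = qcoef1 T * z + (- qcoef2 T) * 1 + qcoef3 T * w
        + (- (5 * T ^+ 3)) * w ^+ 2 + T ^+ 3 * w ^+ 3,
      z ^+ 3 = qcoef1 T * z ^+ 2 + (- qcoef2 T) * z + qcoef3 T * 1
        + (- (5 * T ^+ 3)) * w + T ^+ 3 * w ^+ 2
    & z ^+ 4 = qcoef1 T * z ^+ 3 + (- qcoef2 T) * z ^+ 2 + qcoef3 T * z
        + (- (5 * T ^+ 3)) * 1 + T ^+ 3 * w].
Proof.
have := reciprocal_eq; have w0 := inv_neq0 wz.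
have -> : z = w^-1 by rewrite -[z](mulKf w0) wz mulr1.
move: (qcoef1 T) (qcoef2 T) (qcoef3 T) => c1 c2 c3 e; split; apply/subr0_eq.
- by rewrite -[RHS](mulr0 (w ^+ 4)) -(subrr (w^-1 ^+ 5)) {2}e; field.
- by rewrite -[RHS](mulr0 (w ^+ 3)) -(subrr (w^-1 ^+ 5)) {2}e; field.
- by rewrite -[RHS](mulr0 (w ^+ 2)) -(subrr (w^-1 ^+ 5)) {2}e; field.
by rewrite -[RHS](mulr0 w) -(subrr (w^-1 ^+ 5)) {2}e; field.
Qed.
End Reciprocal.

(** * Exponents modulo 5 in the field of fractions *)

Section GradedFractions.
Variables (R : idomainType) (K : fieldType) (iota : {rmorphism fps R -> K}).
Hypothesis iota_inj : injective iota.
Local Notation "x %:F" := (iota x) : ring_scope.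
Implicit Types (x y : K) (f g G H : fps R).

(* [x] is a quotient of a series with exponents congruent to [i] by a series in [q^5]. *)
Definition weight_over G i x := exists2 f, homog i f & x * (dil 5 G)%:F = f%:F.
Definition weight i x := exists2 G : fps R, G != 0 & weight_over G i x.

Lemma iota_eq0 f : (f%:F == 0) = (f == 0).
Proof. by rewrite -(inj_eq iota_inj) rmorph0. Qed.

Lemma weight_overM G H i x : weight_over G i x -> weight_over (G * H) i x.
Proof.
case=> f hf xf; exists (f * dil 5 H); first by rewrite -[i]addn0; apply: homogM (homog_dil H).
by rewrite !rmorphM /= mulrA xf.
Qed.

Lemma weightW i j x : i = j %[mod 5] -> weight i x -> weight j x.
Proof.
by move=> ij [G G0 [f hf xf]]; exists G => //; exists f => // n; rewrite -ij; apply: hf.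
Qed.

Lemma weightD i x y : weight i x -> weight i y -> weight i (x + y).
Proof.
move=> [G G0 wx] [H H0 wy]; exists (G * H); first exact: mulf_neq0.
have [f hf xf] := weight_overM H wx; have := weight_overM G wy.
rewrite mulrC => -[g hg yg]; exists (f + g); first exact: homogD.
by rewrite mulrDl xf yg rmorphD.
Qed.

Lemma weightM i j x y : weight i x -> weight j y -> weight (i + j) (x * y).
Proof.
move=> [G G0 [f hf xf]] [H H0 [g hg yg]]; exists (G * H); first exact: mulf_neq0.
by exists (f * g); [apply: homogM | rewrite !rmorphM /= mulrACA xf yg].
Qed.

Lemma weight_hom i f : homog i f -> weight i f%:F.
Proof.
move=> hf; exists 1; first exact: oner_neq0.
by exists f => //; rewrite !rmorph1 mulr1.
Qed.

Lemma weight_dilV g : weight 0 (dil 5 g)%:F^-1.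
Proof.
have [->|g0] := eqVneq g 0.
  by rewrite !rmorph0 invr0 -(rmorph0 iota); apply: weight_hom.
exists g => //; exists 1; first by move=> [|n]; rewrite ?mod0n ?eqxx // fcoef1.
by rewrite mulVf ?rmorph1 // iota_eq0 dil_neq0.
Qed.

Lemma weight_int (z : int) : weight 0 z%:~R.
Proof.
rewrite -(rmorph_int iota); apply: weight_hom.
rewrite -(rmorph_int (@dil R 5)); exact: homog_dil.
Qed.

Lemma weightN i x : weight i x -> weight i (- x).
Proof. by move=> wx; rewrite -mulN1r -[i]add0n; apply: weightM wx; apply: (weight_int (-1)). Qed.

Lemma weight0_exp x n : weight 0 x -> weight 0 (x ^+ n).
Proof.
move=> wx; elim: n => [|n IHn]; first by rewrite expr0; apply: (weight_int 1).
by rewrite exprS -[0%N]addn0; apply: weightM.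
Qed.

(** Over a common denominator in [q^5] the five parts become series with exponents in distinct
    classes, and such a decomposition is unique. *)
Lemma weight_comp_eq f x0 x1 x2 x3 x4 :
  weight 0 x0 -> weight 1 x1 -> weight 2 x2 -> weight 3 x3 -> weight 4 x4 ->
  f%:F = x0 + x1 + x2 + x3 + x4 ->
  [/\ (comp 0 f)%:F = x0, (comp 1 f)%:F = x1, (comp 2 f)%:F = x2
    & (comp 3 f)%:F = x3 /\ (comp 4 f)%:F = x4].
Proof.
move=> [G0 n0 w0] [G1 n1 w1] [G2 n2 w2] [G3 n3 w3] [G4 n4 w4] fx.
pose G := G0 * G1 * G2 * G3 * G4.
have Gn : G != 0 by rewrite !mulf_neq0.
have {w0} : weight_over G 0 x0 by do 4!apply: weight_overM.
have {w1} : weight_over G 1 x1.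
  by rewrite /G [G0 * G1]mulrC; do 4!apply: weight_overM.
have {w2} : weight_over G 2 x2.
  by rewrite /G [_ * G2]mulrC; do 2!apply: weight_overM; apply: weight_overM.
have {w3} : weight_over G 3 x3.
  by rewrite /G [_ * G3]mulrC; do 2!apply: weight_overM.
have {w4} : weight_over G 4 x4 by rewrite /G mulrC; apply: weight_overM.
move=> [f4 h4 e4] [f3 h3 e3] [f2 h2 e2] [f1 h1 e1] [f0 h0 e0].
have fG : dil 5 G * f = f0 + f1 + f2 + f3 + f4.
  apply/eqP; rewrite -(inj_eq iota_inj) !rmorphD rmorphM /= fx; apply/eqP.
  by rewrite -e0 -e1 -e2 -e3 -e4; ring.
have C i : dil 5 G * comp i f = comp i f0 + comp i f1 + comp i f2 + comp i f3 + comp i f4.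
  by rewrite -comp_dilM fG !raddfD.
have D i x h : x * (dil 5 G)%:F = h%:F -> dil 5 G * comp i f = h -> (comp i f)%:F = x.
  move=> xh fh; have DG : (dil 5 G)%:F != 0 by rewrite iota_eq0 dil_neq0.
  by apply: (mulIf DG); rewrite xh -fh (rmorphM iota) mulrC.
have Z i j h : homog i h -> i != j %[mod 5] -> comp j h = 0 by apply: homog_comp0.
split; last split.
- by apply: (D 0%N _ _ e0); rewrite C (homog_comp h0)
    (Z _ _ _ _ h1) // (Z _ _ _ _ h2) // (Z _ _ _ _ h3) // (Z _ _ _ _ h4) // !addr0.
- by apply: (D 1%N _ _ e1); rewrite C (homog_comp h1)
    (Z _ _ _ _ h0) // (Z _ _ _ _ h2) // (Z _ _ _ _ h3) // (Z _ _ _ _ h4) // !addr0 add0r.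
- by apply: (D 2%N _ _ e2); rewrite C (homog_comp h2)
    (Z _ _ _ _ h0) // (Z _ _ _ _ h1) // (Z _ _ _ _ h3) // (Z _ _ _ _ h4) // !addr0 !add0r.
- by apply: (D 3%N _ _ e3); rewrite C (homog_comp h3)
    (Z _ _ _ _ h0) // (Z _ _ _ _ h1) // (Z _ _ _ _ h2) // (Z _ _ _ _ h4) // !addr0 !add0r.
by apply: (D 4%N _ _ e4); rewrite C (homog_comp h4)
    (Z _ _ _ _ h0) // (Z _ _ _ _ h1) // (Z _ _ _ _ h2) // (Z _ _ _ _ h3) // !add0r.
Qed.

(** Here [y] is the part of [x] with exponents divisible by 5, not only its coefficient of degree
    0. *)
Definition const_term x y := weight 0 y /\ exists x1 x2 x3 x4,
  [/\ weight 1 x1, weight 2 x2, weight 3 x3, weight 4 x4 & x = y + x1 + x2 + x3 + x4].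

Lemma const_termD x x' y y' :
  const_term x y -> const_term x' y' -> const_term (x + x') (y + y').
Proof.
move=> [w0 [x1 [x2 [x3 [x4 [w1 w2 w3 w4 ->]]]]]] [v0 [z1 [z2 [z3 [z4 [v1 v2 v3 v4 ->]]]]]].
split; first exact: weightD.
exists (x1 + z1), (x2 + z2), (x3 + z3), (x4 + z4); split; try exact: weightD.
ring.
Qed.

Lemma const_termZ s x y : weight 0 s -> const_term x y -> const_term (s * x) (s * y).
Proof.
move=> ws [w0 [x1 [x2 [x3 [x4 [w1 w2 w3 w4 ->]]]]]]; split; first exact: (weightM ws w0).
exists (s * x1), (s * x2), (s * x3), (s * x4).
split; [exact: (weightM ws w1) | exact: (weightM ws w2) | exact: (weightM ws w3)
  | exact: (weightM ws w4) | ring].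
Qed.

Lemma const_term_weight0 x : weight 0 x -> const_term x x.
Proof.
have w i : weight i 0 by rewrite -(rmorph0 iota); apply: weight_hom.
by move=> wx; split=> //; exists 0, 0, 0, 0; split=> //; rewrite !addr0.
Qed.

Lemma const_term_weight i x : weight i x -> i != 0 %[mod 5] -> const_term x 0.
Proof.
have w j : weight j 0 by rewrite -(rmorph0 iota); apply: weight_hom.
move=> wx i0; split=> //; have := ltn_pmod i (isT : (0 < 5)%N).
have {wx} : weight (i %% 5) x by apply: weightW wx; rewrite modn_mod.
case: (i %% 5)%N i0 => [|[|[|[|[|]]]]] //= _ wx _.
- by exists x, 0, 0, 0; split; rewrite ?(add0r, addr0).
- by exists 0, x, 0, 0; split; rewrite ?(add0r, addr0).
- by exists 0, 0, x, 0; split; rewrite ?(add0r, addr0).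
- by exists 0, 0, 0, x; split; rewrite ?(add0r, addr0).
Qed.

Lemma sect_const_term f g : const_term f%:F (dil 5 g)%:F -> sect 5 f = g.
Proof.
move=> [w0 [x1 [x2 [x3 [x4 [w1 w2 w3 w4 fx]]]]]].
have [C _ _ _] := weight_comp_eq w0 w1 w2 w3 w4 fx.
apply: (@dil_inj _ 5) => //; rewrite dil_sect.
by apply/eqP; rewrite -(inj_eq iota_inj) C.
Qed.

End GradedFractions.

(** * The quintic equation for Z *)

Section EulerCubes.
Variable R : idomainType.
Notation q := (fq : fps R).

Lemma comp_fsum i (F : nat -> fps R) : comp i (fsum F) = fsum (fun j => comp i (F j)).
Proof.
apply: fpsP => n; rewrite /= !fcoef_sum; case: ifP => ni.
  by apply: eq_bigr => j _; rewrite /= ni.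
by rewrite big1 // => j _; rewrite /= ni.
Qed.

Lemma homog_int (z : int) : homog 0 (z%:~R : fps R).
Proof. rewrite -(rmorph_int (@dil R 5)); exact: homog_dil. Qed.

Lemma tri_mod5 j : ('C(j.+1, 2) %% 5)%N \in [:: 0; 1; 3]%N.
Proof.
have := tri_double j; rewrite {2 3}(divn_eq j 5).
set k := (j %/ 5)%N; set r := (j %% 5)%N; set T := 'C(_, _).
have -> : ((k * 5 + r) * (k * 5 + r).+1 = 5 * (k * (5 * k + 2 * r + 1)) + r * r.+1)%N by lia.
have : (r < 5)%N by rewrite ltn_pmod.
move: (k * _)%N => m; clearbody r T => r5 Tm; rewrite !inE.
case: r r5 Tm => [|[|[|[|[|]]]]] // _; lia.
Qed.

(** The exponents are triangular numbers, which are 0, 1 or 3 modulo 5. *)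
Lemma comp_jacobi i : i = 2 \/ i = 4 -> comp i (jacobi_series R) = 0.
Proof.
move=> i24; rewrite comp_fsum; apply: fpsP => n; rewrite [LHS]/= fcoef_sum big1 // => j _.
have h : homog 'C(j.+1, 2) ((-1) ^+ j * (2 * j).+1%:R * q ^+ 'C(j.+1, 2)).
  rewrite -[X in homog X]add0n; apply: homogM.
    have := homog_int ((-1) ^+ j * (2 * j).+1%:R).
    by rewrite rmorphM rmorphXn /= rmorphN1 rmorph_nat.
  by move=> m mj; rewrite fcoefqX; case: (m =P _) mj => // ->; rewrite eqxx.
rewrite (homog_comp0 h) //; have := tri_mod5 j; rewrite !inE.
by case: i24 => -> /or3P [] /eqP ->.
Qed.

Lemma comp_dil2 i (f : fps R) : comp (2 * i) (dil 2 f) = dil 2 (comp i f).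
Proof.
apply: fpsP => n /=; case: (boolP (2 %| n)%N) => [/dvdnP [k ->]|_]; last by case: ifP.
by rewrite mulnK //; congr (if _ then _ else _); lia.
Qed.

Lemma euler_neq0 : euler R != 0.
Proof.
by apply/eqP => /(congr1 (fun f => coef f 0)) /eqP; rewrite -(dil1 (euler R)) euler0 // oner_eq0.
Qed.

Lemma euler_dil2_neq0 : dil 2 (euler R) != 0.
Proof. exact: dil_neq0 euler_neq0. Qed.

Lemma phi_psi : phi R * psi R = euler R * dil 2 (euler R).
Proof.
apply: (mulIf (mulf_neq0 euler_neq0 euler_dil2_neq0)).
transitivity ((phi R * dil 2 (euler R)) * (psi R * euler R)); first by ring.
by rewrite phi_euler psi_euler; ring.
Qed.

Lemma phi2_psi : phi R ^+ 2 * psi R = euler R ^+ 3.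
Proof.
apply: (mulIf euler_dil2_neq0).
transitivity ((phi R * dil 2 (euler R)) * (phi R * psi R)); first by ring.
by rewrite phi_euler phi_psi; ring.
Qed.

Lemma phi_psi2 : phi R * psi R ^+ 2 = dil 2 (euler R) ^+ 3.
Proof.
apply: (mulIf euler_neq0).
transitivity ((psi R * euler R) * (phi R * psi R)); first by ring.
by rewrite psi_euler phi_psi; ring.
Qed.

Lemma comp_euler3 i : i = 2 \/ i = 4 -> comp i (phi R ^+ 2 * psi R) = 0.
Proof. by rewrite phi2_psi euler_cube; apply: comp_jacobi. Qed.

(** Replacing [q] by [q^2] doubles exponents, which moves the missing classes 4 and 2 to 3 and 4. *)
Lemma comp_euler3_2 i : i = 3 \/ i = 4 -> comp i (phi R * psi R ^+ 2) = 0.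
Proof.
rewrite phi_psi2 -rmorphXn /= euler_cube => -[] ->.
  rewrite (_ : comp 3 _ = comp (2 * 4) (dil 2 (jacobi_series R))); last exact: fpsP.
  by rewrite comp_dil2 comp_jacobi ?rmorph0 //; right.
by rewrite -[4]/(2 * 2)%N comp_dil2 comp_jacobi ?rmorph0 //; left.
Qed.
End EulerCubes.

(** * Relations between the dissection terms from the vanishing components *)

Section Relations.
Variables (R : idomainType) (K : fieldType) (iota : {rmorphism fps R -> K}).
Hypothesis iota_inj : injective iota.
Local Notation weight := (weight iota).
Variables al be ga de : K.
Hypotheses (wal : weight 1 al) (wbe : weight 4 be) (wga : weight 2 ga) (wde : weight 3 de).

Let w1 : weight 0 1. Proof. exact: (weight_int iota 1). Qed.

Let w2 : weight 0 2. Proof. exact: (weight_int iota 2). Qed.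

Ltac weigh_monomial := first [ eassumption | eapply weightM; weigh_monomial ].
Ltac weigh := first [ apply: weightD; weigh | eapply weightW; last weigh_monomial; done ].

Let weightMW M m i k x : weight m M -> weight i x -> (m + i = k %[mod 5])%N -> weight k (M * x).
Proof. by move=> wM wx e; apply: weightW e (weightM wM wx). Qed.

(** Since [M] has weight 3, components 2 and 4 of [f] are [M] times the parts of weights 4 and 1 of
    the product. *)
Lemma relations34 f M : M != 0 -> weight 3 M ->
  iota f = M * ((1 + al + be) ^+ 2 * (1 + ga + de)) -> comp 2 f = 0 -> comp 4 f = 0 ->
  2 * al + be ^+ 2 * de + 2 * be * ga = 0 /\ 2 * be + al ^+ 2 * ga + 2 * al * de = 0.
Proof.
move=> M0 wM fE f2 f4; rewrite !expr2.
have wp : weight 0 (1 + 2 * (al * be)) by weigh.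
have v0 : weight 0 (1 + 2 * (al * be) + al * al * de + be * be * ga) by weigh.
have v1 : weight 1 (2 * al + be * be * de + 2 * be * ga) by weigh.
have v2 : weight 2 (al * al + (1 + 2 * (al * be)) * ga + 2 * be * de) by weigh.
have v3 : weight 3 (be * be + (1 + 2 * (al * be)) * de + 2 * al * ga) by weigh.
have v4 : weight 4 (2 * be + al * al * ga + 2 * al * de) by weigh.
have [|_ _ C2 [_ C4]] := weight_comp_eq iota_inj (f := f) (@weightMW _ _ _ 0 _ wM v2 erefl)
  (@weightMW _ _ _ 1 _ wM v3 erefl) (@weightMW _ _ _ 2 _ wM v4 erefl)
  (@weightMW _ _ _ 3 _ wM v0 erefl)
  (@weightMW _ _ _ 4 _ wM v1 erefl).
  by rewrite fE; ring.
by split; apply: (mulfI M0); rewrite mulr0 -?C2 -?C4 ?f2 ?f4 rmorph0.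
Qed.

(** Since [M] has weight 1, components 3 and 4 of [f] are [M] times the parts of weights 2 and 3 of
    the product. *)
Lemma relations12 f M : M != 0 -> weight 1 M ->
  iota f = M * ((1 + al + be) * (1 + ga + de) ^+ 2) -> comp 3 f = 0 -> comp 4 f = 0 ->
  2 * ga + al * de ^+ 2 + 2 * be * de = 0 /\ 2 * de + be * ga ^+ 2 + 2 * al * ga = 0.
Proof.
move=> M0 wM fE f3 f4; rewrite !expr2.
have wp : weight 0 (1 + 2 * (ga * de)) by weigh.
have v0 : weight 0 (1 + 2 * (ga * de) + al * (ga * ga) + be * (de * de)) by weigh.
have v1 : weight 1 ((1 + 2 * (ga * de)) * al + de * de + 2 * be * ga) by weigh.
have v2 : weight 2 (2 * ga + al * (de * de) + 2 * be * de) by weigh.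
have v3 : weight 3 (2 * de + be * (ga * ga) + 2 * al * ga) by weigh.
have v4 : weight 4 ((1 + 2 * (ga * de)) * be + ga * ga + 2 * al * de) by weigh.
have [|_ _ _ [C3 C4]] := weight_comp_eq iota_inj (f := f) (@weightMW _ _ _ 0 _ wM v4 erefl)
  (@weightMW _ _ _ 1 _ wM v0 erefl) (@weightMW _ _ _ 2 _ wM v1 erefl)
  (@weightMW _ _ _ 3 _ wM v2 erefl)
  (@weightMW _ _ _ 4 _ wM v3 erefl).
  by rewrite fE; ring.
by split; apply: (mulfI M0); rewrite mulr0 -?C3 -?C4 ?f3 ?f4 rmorph0.
Qed.
End Relations.

(** * The equation of [Z] over series in [q^5], and the recurrence for [U(Z^k)] *)

Section Equation.
Notation R := int.
Notation q := (fq : fps R).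
Variables (K : fieldType) (iota : {rmorphism fps R -> K}).
Hypothesis iota_inj : injective iota.
Local Notation "x %:F" := (iota x) : ring_scope.
Local Notation weight := (weight iota).
Notation phi := (phi R).
Notation psi := (psi R).

Let A : K := (dil 25 phi)%:F.
Let N : K := q%:F ^+ 3 * (dil 25 psi)%:F.
Let al := (comp 1 phi)%:F / A.
Let be := (comp 4 phi)%:F / A.
Let ga := (comp 0 psi)%:F / N.
Let de := (comp 1 psi)%:F / N.

Lemma phi_neq0 : phi != 0.
Proof. by apply: contraNneq (euler_neq0 R) => p0; rewrite -sqrf_eq0 -phi_euler p0 mul0r. Qed.

Lemma psi_neq0 : psi != 0.
Proof.
by apply: contraNneq (euler_dil2_neq0 R) => p0; rewrite -sqrf_eq0 -psi_euler p0 mul0r.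
Qed.

Let A0 : A != 0. Proof. by rewrite (iota_eq0 iota_inj) dil_neq0 // phi_neq0. Qed.

Let N0 : N != 0.
Proof. by rewrite mulf_neq0 ?expf_neq0 // (iota_eq0 iota_inj) ?fq_neq0 // dil_neq0 // psi_neq0. Qed.

Let c2 : 2 != 0 :> K.
Proof.
by rewrite -(rmorph_nat iota) (iota_eq0 iota_inj); apply/eqP => /(congr1 (fun f => coef f 0)).
Qed.

Let wq : weight 1 q%:F.
Proof. by apply: weight_hom => n; rewrite /=; case: (n =P 1%N) => [->|]. Qed.

Let wqX k : weight k (q%:F ^+ k).
Proof.
elim: k => [|k IHk]; first exact: (weight_int iota 1).
by rewrite exprS -add1n; apply: weightM.
Qed.

Let wA : weight 0 A.
Proof. by apply: weight_hom; rewrite /A -(@dil_dil _ 5 5) //; apply: homog_dil. Qed.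

Let wAV : weight 0 A^-1.
Proof. by rewrite /A -(@dil_dil _ 5 5) //; apply: weight_dilV. Qed.

Let wN : weight 3 N.
Proof.
apply: (weightM (wqX 3)); apply: weight_hom.
by rewrite -(@dil_dil _ 5 5) //; apply: homog_dil.
Qed.

Let wNV : weight 2 N^-1.
Proof.
rewrite invfM; apply: (@weightM _ _ iota 2 0); last first.
  by rewrite -(@dil_dil _ 5 5) //; apply: weight_dilV.
(* Writing [1 / q^3] as [q^2 / q^5] exhibits its weight 2. *)
have -> : (q%:F ^+ 3)^-1 = q%:F ^+ 2 * (dil 5 q)%:F^-1.
  rewrite dil_fq // rmorphXn /=; have : q%:F != 0 by rewrite (iota_eq0 iota_inj) fq_neq0.
  by move: (q%:F) => x x0; field.
exact: (@weightM _ _ iota 2 0 _ _ (wqX 2) (weight_dilV iota_inj _)).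
Qed.

Let wal : weight 1 al. Proof. exact: (weightM (weight_hom iota (@comp_homog _ 1 phi)) wAV). Qed.

Let wbe : weight 4 be. Proof. exact: (weightM (weight_hom iota (@comp_homog _ 4 phi)) wAV). Qed.

Let wga : weight 2 ga. Proof. exact: (weightM (weight_hom iota (@comp_homog _ 0 psi)) wNV). Qed.

Let wde : weight 3 de. Proof. exact: (weightM (weight_hom iota (@comp_homog _ 1 psi)) wNV). Qed.

Let phiE : phi%:F = A * (1 + al + be).
Proof.
have [H0 H2 H3 _] := phi_comps R.
rewrite {1}[phi]comp_sum H0 H2 H3 !addr0 !rmorphD /= -/A /al /be.
by rewrite !mulrDr mulr1 ![A * (_ / A)]mulrCA !divff // !mulr1.
Qed.

Let psiE : psi%:F = N * (1 + ga + de).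
Proof.
have [H3 H2 H4 _] := psi_comps (isT : 2 != 0 :> R).
rewrite {1}[psi]comp_sum H3 H2 H4 !addr0 !rmorphD /= rmorphM rmorphXn /= -/N /ga /de.
by rewrite !mulrDr mulr1 ![N * (_ / N)]mulrCA !divff // !mulr1; ring.
Qed.

Let de0 : de != 0.
Proof.
rewrite mulf_neq0 ?invr_eq0 // (iota_eq0 iota_inj); apply/eqP => /(congr1 (fun f => coef f 1)).
rewrite -[LHS]/(coef (\sum_(j < 2) q ^+ 'C(j.+1, 2)) 1) fcoef_sum.
by rewrite !big_ord_recl big_ord0 !fcoefqX.
Qed.

Let alE : 1 + al * be = (dil 5 phi)%:F ^+ 2 / A ^+ 2.
Proof.
have [_ _ _ /(congr1 iota)] := phi_comps R.
rewrite rmorphM rmorphB !rmorphXn /= -/A => H.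
rewrite /al /be mulrACA -invfM H -expr2 mulrBl divff ?expf_neq0 //; ring.
Qed.

Let gaE : 1 + ga * de = q%:F * (dil 5 psi)%:F ^+ 2 / N ^+ 2.
Proof.
have [_ _ _ /(congr1 iota)] := psi_comps (isT : 2 != 0 :> R).
rewrite !(rmorphM, rmorphB, rmorphXn) /= => H.
rewrite /ga /de mulrACA -invfM H -expr2; move: N0; rewrite /N.
move: (q%:F) ((dil 25 psi)%:F) ((dil 5 psi)%:F) => x y z.
by rewrite mulf_eq0 expf_eq0 /= negb_or => /andP [x0 y0]; field; rewrite x0 y0.
Qed.

Let rels : (2 * ga + al * de ^+ 2 + 2 * be * de = 0 /\ 2 * de + be * ga ^+ 2 + 2 * al * ga = 0) /\
  (2 * al + be ^+ 2 * de + 2 * be * ga = 0 /\ 2 * be + al ^+ 2 * ga + 2 * al * de = 0).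
Proof.
split.
  apply: (relations12 iota_inj wal wbe wga wde (M := A * N ^+ 2) (f := phi * psi ^+ 2)).
  - by rewrite mulf_neq0 ?expf_neq0.
  - by apply: (@weightW _ _ _ (0 + (3 + 3))) => //; rewrite expr2; do 2!apply: weightM => //.
  - rewrite rmorphM rmorphXn /= phiE psiE; move: A N al be ga de => *; ring.
  - by apply: comp_euler3_2; left.
  - by apply: comp_euler3_2; right.
apply: (relations34 iota_inj wal wbe wga wde (M := A ^+ 2 * N) (f := phi ^+ 2 * psi)).
- by rewrite mulf_neq0 ?expf_neq0.
- by apply: (@weightM _ _ _ 0 3) => //; apply: weight0_exp.
- rewrite rmorphM rmorphXn /= phiE psiE; move: A N al be ga de => *; ring.
- by apply: comp_euler3; left.
- by apply: comp_euler3; right.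
Qed.

Definition euler12 : fps R := euler R * dil 2 (euler R).
Definition Zser := q ^+ 3 * dil 25 euler12 / euler12.
Definition tser := q * (dil 5 euler12 / euler12) ^+ 2.

Lemma euler12_unit : euler12 \is a GRing.unit.
Proof.
apply: fps_unitP; rewrite fcoefM big_ord1 subnn euler0 // mulr1.
by rewrite -(dil1 (euler R)) euler0.
Qed.

Lemma Zser_euler12 : Zser * euler12 = q ^+ 3 * dil 25 euler12.
Proof. by rewrite divrK // euler12_unit. Qed.

Lemma tser_euler12 : tser * euler12 ^+ 2 = q * dil 5 euler12 ^+ 2.
Proof. by rewrite -mulrA -exprMn divrK // euler12_unit. Qed.

Let W := (1 + (al + be)) * (1 + (ga + de)).
Let tau := (1 + al * be) * (1 + ga * de).
Let z := Zser%:F.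
Let T := (dil 5 tser)%:F.

Let cub0 : euler12 != 0.
Proof. by apply: contraTneq euler12_unit => ->; rewrite unitr0. Qed.

(** As [phi psi = F], the dissections give [F = A N W], while [A N = q^3 F_25]. *)
Let WzE : W * z = 1.
Proof.
have AN : A * N = (q ^+ 3 * dil 25 euler12)%:F.
  rewrite [RHS]rmorphM rmorphXn /= /euler12 -phi_psi.
  rewrite (rmorphM (@dil R 25)) (rmorphM iota (dil 25 phi)) /=.
  by rewrite /A /N mulrCA.
have AN0 : A * N != 0 by rewrite mulf_neq0.
have cubE : euler12%:F = A * N * W.
  rewrite /euler12 -phi_psi rmorphM /= phiE psiE /W.
  by move: A N al be ga de => *; ring.
by apply: (mulfI AN0); rewrite mulrA -cubE mulr1 -rmorphM mulrC Zser_euler12 -AN.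
Qed.

(** By [alE] and [gaE], [tau] is [F_5^2 / (q^5 F_25^2)], and [T] is the inverse of this. *)
Let tauTE : tau * T = 1.
Proof.
have mulsqr f g d : (dil d (f * g ^+ 2))%:F = (dil d f)%:F * (dil d g)%:F ^+ 2.
  by rewrite (rmorphM (@dil R d)) rmorphXn (rmorphM iota) rmorphXn.
have cub5 : (dil 5 euler12)%:F ^+ 2 != 0.
  by rewrite expf_neq0 // (iota_eq0 iota_inj) dil_neq0.
have TE : T * (dil 5 euler12)%:F ^+ 2 = q%:F ^+ 5 * (dil 25 euler12)%:F ^+ 2.
  transitivity (dil 5 (tser * euler12 ^+ 2))%:F.
    by rewrite mulsqr.
  rewrite tser_euler12; transitivity ((dil 5 q)%:F * (dil 5 (dil 5 euler12))%:F ^+ 2).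
    by rewrite mulsqr.
  by rewrite dil_fq // dil_dil // rmorphXn.
apply: (mulIf cub5); rewrite -mulrA TE mul1r /tau alE gaE /A /N /euler12 -!phi_psi !rmorphM /=.
have : q%:F != 0 by rewrite (iota_eq0 iota_inj) fq_neq0.
have : (dil 25 phi)%:F != 0 by rewrite (iota_eq0 iota_inj) dil_neq0 // phi_neq0.
have : (dil 25 psi)%:F != 0 by rewrite (iota_eq0 iota_inj) dil_neq0 // psi_neq0.
move: (q%:F) ((dil 25 phi)%:F) ((dil 25 psi)%:F) ((dil 5 phi)%:F) ((dil 5 psi)%:F).
by move=> x y u v w u0 y0 x0; field; rewrite x0 y0 u0.
Qed.

Let W0 : W != 0. Proof. by apply/eqP => W0; move/eqP: WzE; rewrite W0 mul0r eq_sym oner_eq0. Qed.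

Let tau0 : tau != 0.
Proof. by apply/eqP => t0; move/eqP: tauTE; rewrite t0 mul0r eq_sym oner_eq0. Qed.

Let P := al * be / 2.
Let V := ga * de / 2.
Let a := al + be.
Let c := ga + de.
Let d := (al * de + be * ga) / 2.
Let e := (al * ga + be * de) / 2.

Let tauE : tau = 2 * P + 2 * V - 3.
Proof.
have [[R1 R2] [R3 R4]] := rels; have := invariants_eq de0 R1 R2 R3; rewrite /tau /P /V.
move: (al * be) (ga * de) c2 => x y n2 xy.
by transitivity (1 + x + y + x * y); [ring | rewrite xy; field].
Qed.

Let powersW :
  [/\ W = comb5 a c d e 1 1 1 2 2,
   W ^+ 2 = comb5 a c d e (1 - 4 * P - 4 * V) (6 + 2 * V) (6 + 2 * P) (4 - 2 * V) (4 - 2 * P),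
   W ^+ 3 = comb5 a c d e 25 (1 - 6 * P + 2 * V - 2 * V ^+ 2) (1 - 6 * V + 2 * P - 2 * P ^+ 2)
      (10 - 30 * V) (10 - 30 * P),
   W ^+ 4 = comb5 a c d e (-127 + 24 * P + 24 * V - 8 * P ^+ 2 - 8 * V ^+ 2)
      (20 - 20 * P - 60 * V - 40 * V ^+ 2) (20 - 20 * V - 60 * P - 40 * P ^+ 2)
      (64 + 72 * P - 108 * V - 4 * P ^+ 2 + 16 * V ^+ 2)
      (64 + 72 * V - 108 * P - 4 * V ^+ 2 + 16 * P ^+ 2)
    & W ^+ 5 - 5 * W ^+ 4 + (5 * tau + 25) * W ^+ 3 - (25 * tau + 125) * W ^+ 2
      + (15 * tau ^+ 2 + 125 * tau + 625) * W - tau ^+ 3 = 0].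
Proof.
have [[R1 R2] [R3 R4]] := rels.
have [[aa ac ad ae] [cc cd ce PV]] := mult_table c2 de0 R1 R2 R3 R4.
have -> : tau = (1 + 2 * P) * (1 + 2 * V) 
  by rewrite /tau /P /V ![2 * (_ / 2)]mulrCA !divff // !mulr1.
split.
- exact: (norm_pow1 aa ac ad ae cc cd ce).
- exact: (norm_pow2 aa ac ad ae cc cd ce PV).
- exact: (norm_pow3 aa ac ad ae cc cd ce PV).
- exact: (norm_pow4 aa ac ad ae cc cd ce PV).
- exact: (norm_quintic aa ac ad ae cc cd ce PV).
Qed.

Let zT_eq :
  z ^+ 5 = qcoef1 T * z ^+ 4 - qcoef2 T * z ^+ 3 + qcoef3 T * z ^+ 2 - 5 * T ^+ 3 * z + T ^+ 3.
Proof.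
by have [_ _ _ _] := powersW; apply: reciprocal_eq. Qed.

Let wt0_nat n : weight 0 n%:R. Proof. exact: (weight_int iota n). Qed.

Ltac weigh0 := first [ assumption | exact: (wt0_nat 1) | exact: wt0_nat | apply: weightD; weigh0
  | apply: weightN; weigh0 | apply: weight0_exp; weigh0 | apply: (@weightM _ _ iota 0 0); weigh0 ].

Let w2V : weight 0 (2 : K)^-1.
Proof.
rewrite -[2](rmorph_nat iota) -[X in iota X](rmorph_nat (@dil R 5)).
exact: weight_dilV.
Qed.

Let wT : weight 0 T. Proof. by apply: weight_hom; apply: homog_dil. Qed.

Let wP : weight 0 P.
Proof. by apply: (@weightM _ _ iota 0 0) => //; apply: weightW (weightM wal wbe). Qed.

Let wV : weight 0 V.
Proof. by apply: (@weightM _ _ iota 0 0) => //; apply: weightW (weightM wga wde). Qed.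

(** The elements [a] and [d] have parts of weights 1 and 4, and [c] and [e] of weights 2 and 3; only
    the first coordinate has weight 0. *)
Let const_term_lc x0 x1 x2 x3 x4 : weight 0 x0 -> weight 0 x1 -> weight 0 x2 ->
  weight 0 x3 -> weight 0 x4 -> const_term iota (comb5 a c d e x0 x1 x2 x3 x4) x0.
Proof.
move=> w0 w1 w2 w3 w4.
have ct i x : weight i x -> i != 0 %[mod 5] -> const_term iota x 0 by apply: const_term_weight.
have ctD x y : const_term iota x 0 -> const_term iota y 0 -> const_term iota (x + y) 0.
  by move=> cx /(const_termD cx); rewrite addr0.
have ctZ s x : weight 0 s -> const_term iota x 0 -> const_term iota (s * x) 0.
  by move=> ws /(const_termZ ws); rewrite mulr0.
have ctD0 x y u : const_term iota x u -> const_term iota y 0 -> const_term iota (x + y) u.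
  by move=> cx /(const_termD cx); rewrite addr0.
apply: (ctD0 _ _ _ (ctD0 _ _ _ (ctD0 _ _ _ (ctD0 _ _ _ (const_term_weight0 w0) _) _) _) _);
  apply: (ctZ _ _ _ _) => //.
- by apply: ctD; [apply: ct wal _ | apply: ct wbe _].
- by apply: ctD; [apply: ct wga _ | apply: ct wde _].
- rewrite /d mulrC; apply: ctZ => //.
  by apply: ctD; [apply: (ct _ _ (weightM wal wde)) | apply: (ct _ _ (weightM wbe wga))].
rewrite /e mulrC; apply: ctZ => //.
by apply: ctD; [apply: (ct _ _ (weightM wal wga)) | apply: (ct _ _ (weightM wbe wde))].
Qed.

Let ctW : [/\ const_term iota W 1, const_term iota (W ^+ 2) (- 5 - 2 * tau),
  const_term iota (W ^+ 3) 25 & const_term iota (W ^+ 4) (- 2 * tau ^+ 2 - 125)].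
Proof.
have [-> -> -> -> _] := powersW; rewrite tauE; split.
- by apply: const_term_lc; weigh0.
- have -> : -5 - 2 * (2 * P + 2 * V - 3) = 1 - 4 * P - 4 * V by ring.
  by apply: const_term_lc; weigh0.
- by apply: const_term_lc; weigh0.
have [[R1 R2] [R3 R4]] := rels.
have [_ [_ _ _ PV]] := mult_table c2 de0 R1 R2 R3 R4.
have -> : - 2 * (2 * P + 2 * V - 3) ^+ 2 - 125 = -127 + 24 * P + 24 * V - 8 * P ^+ 2 - 8 * V ^+ 2.
  transitivity (-143 + 24 * P + 24 * V - 8 * P ^+ 2 - 8 * V ^+ 2 - 16 * (P * V)); first by ring.
  by rewrite PV; ring.
by apply: const_term_lc; weigh0.
Qed.

Definition sectZ k := sect 5 (Zser ^+ k).

(** The quintic times [Z^k], to which [U] is applied: its coefficients are polynomials in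
    [T = t(q^5)] and come out with [t] in place of [T]. *)
Lemma sectZ_rec k : sectZ (5 + k) = qcoef1 tser * sectZ (4 + k) - qcoef2 tser * sectZ (3 + k)
  + qcoef3 tser * sectZ (2 + k) - 5 * tser ^+ 3 * sectZ (1 + k) + tser ^+ 3 * sectZ k.
Proof.
have f (x y : fps R) : (qcoef1 x * y ^+ 4 - qcoef2 x * y ^+ 3 + qcoef3 x * y ^+ 2
   - 5 * x ^+ 3 * y + x ^+ 3)%:F
   = qcoef1 x%:F * y%:F ^+ 4 - qcoef2 x%:F * y%:F ^+ 3 + qcoef3 x%:F * y%:F ^+ 2
   - 5 * x%:F ^+ 3 * y%:F + x%:F ^+ 3.
  by rewrite /qcoef1 /qcoef2 /qcoef3; ring.
have eq5 : Zser ^+ 5 = qcoef1 (dil 5 tser) * Zser ^+ 4 - qcoef2 (dil 5 tser) * Zser ^+ 3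
    + qcoef3 (dil 5 tser) * Zser ^+ 2 - 5 * dil 5 tser ^+ 3 * Zser + dil 5 tser ^+ 3.
  by apply: iota_inj; rewrite f rmorphXn zT_eq.
rewrite /sectZ exprD eq5; move: Zser tser => Z' t'.
transitivity (sect 5 (dil 5 (qcoef1 t') * Z' ^+ (4 + k) - dil 5 (qcoef2 t') * Z' ^+ (3 + k)
    + dil 5 (qcoef3 t') * Z' ^+ (2 + k) - dil 5 (5 * t' ^+ 3) * Z' ^+ (1 + k)
    + dil 5 (t' ^+ 3) * Z' ^+ k)).
  by congr (sect 5 _); rewrite !exprD /qcoef1 /qcoef2 /qcoef3; ring.
have sD (g h : fps R) : sect 5 (g + h) = sect 5 g + sect 5 h := raddfD _ g h.
have sB (g h : fps R) : sect 5 (g - h) = sect 5 g - sect 5 h := raddfB _ g h.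
move: (qcoef1 t') (qcoef2 t') (qcoef3 t') (5 * t' ^+ 3) (t' ^+ 3) => m1 m2 m3 m4 m5.
by rewrite [LHS]sD; congr (_ + _); [rewrite [LHS]sB; congr (_ - _); [rewrite [LHS]sD; congr (_ + _);
  [rewrite [LHS]sB; congr (_ - _)|]|]|]; apply: sect_dilM.
Qed.

Let D g := (dil 5 g)%:F.
Let ctM s x y : weight 0 s -> const_term iota x y -> const_term iota (s * x) (s * y).
Proof. exact: const_termZ. Qed.

Let ct1 : const_term iota 1 1. Proof. exact: const_term_weight0 (wt0_nat 1). Qed.

Let sectD f g y : const_term iota f%:F y -> y = D g -> sect 5 f = g.
Proof. by move=> cf yg; apply: (sect_const_term iota_inj); rewrite -/(D g) -yg. Qed.

(** The weight-0 part of [z^k] follows from those of lower powers of [z] and of the powers of [W];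
    [tau T = 1] then eliminates [tau]. *)
Lemma sectZ_low :
  [/\ sectZ 1 = 3 * tser + 25 * tser ^+ 2 + 125 * tser ^+ 3,
      sectZ 2 = qcoef1 tser * sectZ 1 - 10 * tser ^+ 2 - 50 * tser ^+ 3,
      sectZ 3 = qcoef1 tser * sectZ 2 - qcoef2 tser * sectZ 1 + 3 * tser ^+ 2 + 15 * tser ^+ 3
    & sectZ 4 = qcoef1 tser * sectZ 3 - qcoef2 tser * sectZ 2
        + qcoef3 tser * sectZ 1 - 4 * tser ^+ 3].
Proof.
have [cw1 cw2 cw3 cw4] := ctW; have [_ _ _ _ eqW] := powersW.
have [e1 e2 e3 e4] := reciprocal_eq_low WzE tauTE eqW.
have v1 : weight 0 (qcoef1 T) by rewrite /qcoef1; weigh0.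
have v2 : weight 0 (- qcoef2 T) by rewrite /qcoef2; weigh0.
have v3 : weight 0 (qcoef3 T) by rewrite /qcoef3; weigh0.
have v4 : weight 0 (- (5 * T ^+ 3)) by weigh0.
have v5 : weight 0 (T ^+ 3) by weigh0.
have comb x0 x1 x2 x3 x4 y0 y1 y2 y3 y4 : const_term iota x0 y0 -> const_term iota x1 y1 ->
    const_term iota x2 y2 -> const_term iota x3 y3 -> const_term iota x4 y4 ->
  const_term iota (qcoef1 T * x0 + (- qcoef2 T) * x1 + qcoef3 T * x2
      + (- (5 * T ^+ 3)) * x3 + T ^+ 3 * x4)
   (qcoef1 T * y0 + (- qcoef2 T) * y1 + qcoef3 T * y2 + (- (5 * T ^+ 3)) * y3 + T ^+ 3 * y4).
  by move=> *; do 4?[apply: const_termD]; apply: ctM.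
have t1 : T ^+ 3 * tau = T ^+ 2 by rewrite exprSr -mulrA [T * tau]mulrC tauTE mulr1.
have t2 : T ^+ 3 * tau ^+ 2 = T by rewrite expr2 mulrA t1 expr2 -mulrA [T * tau]mulrC tauTE mulr1.
have zk k : z ^+ k = (Zser ^+ k)%:F by rewrite rmorphXn.
have D1 : D (3 * tser + 25 * tser ^+ 2 + 125 * tser ^+ 3) = 3 * T + 25 * T ^+ 2 + 125 * T ^+ 3.
  by rewrite /D /T; move: tser => x; ring.
have D2 g : D (qcoef1 tser * g - 10 * tser ^+ 2 - 50 * tser ^+ 3)
    = qcoef1 T * D g - 10 * T ^+ 2 - 50 * T ^+ 3.
  by rewrite /D /T; move: tser => x; rewrite /qcoef1; ring.
have D3 g h : D (qcoef1 tser * g - qcoef2 tser * h + 3 * tser ^+ 2 + 15 * tser ^+ 3)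
    = qcoef1 T * D g - qcoef2 T * D h + 3 * T ^+ 2 + 15 * T ^+ 3.
  by rewrite /D /T; move: tser => x; rewrite /qcoef1 /qcoef2; ring.
have D4 g h k : D (qcoef1 tser * g - qcoef2 tser * h + qcoef3 tser * k - 4 * tser ^+ 3)
    = qcoef1 T * D g - qcoef2 T * D h + qcoef3 T * D k - 4 * T ^+ 3.
  by rewrite /D /T; move: tser => x; rewrite /qcoef1 /qcoef2 /qcoef3; ring.
have sectC k y g : const_term iota (z ^+ k) y -> y = D g ->
    sectZ k = g /\ const_term iota (z ^+ k) (D (sectZ k)).
  move=> C yg; have S : sectZ k = g by apply: sectD yg; rewrite -zk; exact: C.
  by split; rewrite // S -yg.
have C1 := comb _ _ _ _ _ _ _ _ _ _ ct1 cw1 cw2 cw3 cw4; rewrite -e1 -[z]expr1 in C1.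
have {C1}[|S1 C1] := sectC _ _ (3 * tser + 25 * tser ^+ 2 + 125 * tser ^+ 3) C1.
  rewrite [RHS]D1.
  transitivity (qcoef1 T - qcoef2 T - 5 * qcoef3 T - 250 * T ^+ 3
     - 2 * (5 * T + 25 * T ^+ 2) * (tau * T)
     - 2 * T * (tau * T) ^+ 2); first by rewrite /qcoef3; ring.
  by rewrite tauTE /qcoef1 /qcoef2 /qcoef3; ring.
have C2 := comb _ _ _ _ _ _ _ _ _ _ C1 ct1 cw1 cw2 cw3; rewrite expr1 -e2 in C2.
have {C2}[|S2 C2] := sectC _ _ (qcoef1 tser * sectZ 1 - 10 * tser ^+ 2 - 50 * tser ^+ 3) C2.
  rewrite [RHS]D2; move: (D (sectZ 1)) => y1.
  transitivity (qcoef1 T * y1 - qcoef2 T + qcoef3 T + 50 * T ^+ 3 + 10 * T ^+ 2 * (tau * T)).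
    by ring.
  by rewrite tauTE /qcoef2 /qcoef3; ring.
have C3 := comb _ _ _ _ _ _ _ _ _ _ C2 C1 ct1 cw1 cw2; rewrite expr1 -e3 in C3.
have {C3}[|S3 C3] := sectC _ _ (qcoef1 tser * sectZ 2 - qcoef2 tser * sectZ 1
    + 3 * tser ^+ 2 + 15 * tser ^+ 3) C3.
  rewrite [RHS]D3; move: (D (sectZ 1)) (D (sectZ 2)) => y1 y2.
  transitivity (qcoef1 T * y2 - qcoef2 T * y1 + qcoef3 T - 10 * T ^+ 3
    - 2 * T ^+ 2 * (tau * T)); first by ring.
  by rewrite tauTE /qcoef3; ring.
have C4 := comb _ _ _ _ _ _ _ _ _ _ C3 C2 C1 ct1 cw1; rewrite expr1 -e4 in C4.
have {C4}[|S4 _] := sectC _ _ (qcoef1 tser * sectZ 3 - qcoef2 tser * sectZ 2 + qcoef3 tser * sectZ 1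
    - 4 * tser ^+ 3) C4.
  by rewrite [RHS]D4; move: (D (sectZ 1)) (D (sectZ 2)) (D (sectZ 3)) => *; ring.
by split.
Qed.

End Equation.

(** * Divisibility by powers of 5 *)

Section IntegerSpan.
Variable V : zmodType.
Implicit Types (G H : V -> Prop) (x y : V).

Inductive ispan G : V -> Prop :=
| ispan0 : ispan G 0
| ispanS (m : int) g x : G g -> ispan G x -> ispan G (g *~ m + x).

Lemma ispan_gen G g : G g -> ispan G g.
Proof. by move=> Gg; rewrite -[g]addr0 -[g]mulr1z; apply: ispanS => //; apply: ispan0. Qed.

Lemma ispanD G x y : ispan G x -> ispan G y -> ispan G (x + y).
Proof.
by elim=> [|m g z Gg _ IH] Gy; [rewrite add0r | rewrite -addrA; apply: ispanS; last apply: IH].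
Qed.

Lemma ispanMz G x m : ispan G x -> ispan G (x *~ m).
Proof.
elim=> [|k g z Gg _ IH]; first by rewrite mul0rz; apply: ispan0.
by rewrite mulrzDl -mulrzA; apply: ispanS.
Qed.

Lemma ispanN G x : ispan G x -> ispan G (- x).
Proof. by rewrite -[- x]mulrN1z; apply: ispanMz. Qed.
End IntegerSpan.

Lemma ispan_mul (A : pzRingType) (a : A) (G H : A -> Prop) x :
  (forall g, G g -> ispan H (a * g)) -> ispan G x -> ispan H (a * x).
Proof.
move=> aG; elim=> [|m g z Gg _ IH]; first by rewrite mulr0; apply: ispan0.
by rewrite mulrDr mulrzAr; apply: ispanD => //; apply/ispanMz/aG.
Qed.

(** * Polynomials in [t] with coefficients divisible by prescribed powers of 5 *)

Section Spans.
Notation R := int.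
Notation q := (fq : fps R).
Notation t := tser.
Implicit Types (x y : fps R) (w : nat -> nat).

(** The integer span consists of the polynomials in [t] without terms below [t^m] whose coefficient
    of [t^j] is divisible by [5^(w j)]. *)
Definition tgen w m x := exists2 j, (m <= j)%N & x = 5 ^+ w j * t ^+ j.
Definition tspan w m := ispan (tgen w m).

Lemma tspan_term w m (k : nat) e j : (m <= j)%N -> (w j <= e)%N ->
  tspan w m (k%:R * 5 ^+ e * t ^+ j).
Proof.
move=> mj we; have -> : k%:R * 5 ^+ e * t ^+ j = (5 ^+ w j * t ^+ j) *~ (k * 5 ^ (e - w j))%N.
  by rewrite -(subnK we) exprD addnK -pmulrn -[RHS]mulr_natl natrM natrX; ring.
by apply/ispanMz/ispan_gen; exists j.
Qed.

Lemma tspan_nat w m (c : nat) e j : (m <= j)%N -> (w j <= e)%N ->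
  tspan w m ((c * 5 ^ e)%:R * t ^+ j).
Proof. by move=> mj we; rewrite natrM natrX; apply: tspan_term. Qed.

Lemma tspan_mul w m w' m' (k : nat) e l x :
  (forall j, (m <= j)%N -> (m' <= l + j)%N /\ (w' (l + j) <= e + w j)%N) ->
  tspan w m x -> tspan w' m' (k%:R * 5 ^+ e * t ^+ l * x).
Proof.
move=> H; apply: ispan_mul => _ [j mj ->].
have -> : k%:R * 5 ^+ e * t ^+ l * (5 ^+ w j * t ^+ j) = k%:R * 5 ^+ (e + w j) * t ^+ (l + j).
  by rewrite !exprD; ring.
by have [? ?] := H j mj; apply: tspan_term.
Qed.

Lemma tspan_unshift w m i x : tspan w (i + m) x ->
  exists2 y, x = t ^+ i * y & tspan (fun j => w (i + j)%N) m y.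
Proof.
elim=> [|n g z [j ij ->] _ [y -> Hy]]; first by exists 0; [rewrite mulr0 | apply: ispan0].
exists ((5 ^+ w j * t ^+ (j - i)) *~ n + y).
  rewrite mulrDr mulrzAr; congr (_ *~ _ + _).
  by rewrite mulrCA -exprD subnKC //; lia.
apply: ispanS => //; exists (j - i)%N; first lia.
by rewrite subnKC //; lia.
Qed.

(** The subtraction is truncated, so a negative exponent imposes no divisibility. The lower bound on
    [j] leaves a factor [t] after division by [t^(floor(k/2))]. *)
Definition zspan k := tspan (fun j => (5 * j).-1 %/ 3 - k)%N k./2.+1.

(** For each monomial [5^e t^l] of the coefficient, the bound at [j + l] exceeds the one at [j] by
    at most [e]. The same check for the other coefficients makes the recurrence respect the
    bounds. *)
Lemma zspan_qcoef1 k x : (0 < k)%N -> zspan k x -> zspan k.+1 (qcoef1 t * x).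
Proof.
move=> k0 Hx; have -> : qcoef1 t * x = 3%:R * 5 ^+ 1 * t ^+ 1 * x + 1%:R * 5 ^+ 3 * t ^+ 2 * x
   + 1%:R * 5 ^+ 4 * t ^+ 3 * x by rewrite /qcoef1; ring.
by do ![apply: ispanD]; apply: tspan_mul Hx => j kj; lia.
Qed.

Lemma zspan_qcoef2 k x : (0 < k)%N -> zspan k x -> zspan k.+2 (qcoef2 t * x).
Proof.
move=> k0 Hx; have -> : qcoef2 t * x = 1%:R * 5 ^+ 2 * t ^+ 2 * x + 1%:R * 5 ^+ 3 * t ^+ 3 * x.
  by rewrite /qcoef2; ring.
by apply: ispanD; apply: tspan_mul Hx => j kj; lia.
Qed.

Lemma zspan_qcoef3 k x : (0 < k)%N -> zspan k x -> zspan k.+3 (qcoef3 t * x).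
Proof.
move=> k0 Hx; have -> : qcoef3 t * x = 1%:R * 5 ^+ 1 * t ^+ 2 * x + 1%:R * 5 ^+ 2 * t ^+ 3 * x.
  by rewrite /qcoef3; ring.
by apply: ispanD; apply: tspan_mul Hx => j kj; lia.
Qed.

Lemma zspan_qcoef4 k x : (0 < k)%N -> zspan k x -> zspan k.+4 (5 * t ^+ 3 * x).
Proof.
move=> k0 Hx; have -> : 5 * t ^+ 3 * x = 1%:R * 5 ^+ 1 * t ^+ 3 * x by ring.
by apply: tspan_mul Hx => j kj; lia.
Qed.

Lemma zspan_qcoef5 k x : (0 < k)%N -> zspan k x -> zspan (5 + k) (t ^+ 3 * x).
Proof.
move=> k0 Hx; have -> : t ^+ 3 * x = 1%:R * 5 ^+ 0 * t ^+ 3 * x by ring.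
by apply: tspan_mul Hx => j kj; lia.
Qed.

Let iota := (@FracField.tofrac (fps R)).
Let iota_inj : injective iota.
Proof. by move=> x y /eqP; rewrite tofrac_eq => /eqP. Qed.

Lemma sectZ0 : sectZ 0 = 1.
Proof. by rewrite -[RHS](sect_dil 1 (isT : 0 < 5)%N) rmorph1. Qed.

Lemma sectZ_span k : (0 < k)%N -> zspan k (sectZ k).
Proof.
have [S1 S2 S3 S4] := sectZ_low iota_inj.
have H1 : zspan 1 (sectZ 1).
  rewrite S1 -[t in 3 * t]expr1.
  by do 2?apply: ispanD; [apply: (@tspan_nat _ _ 3%N 0%N) | apply: (@tspan_nat _ _ 1%N 2%N)
    | apply: (@tspan_nat _ _ 1%N 3%N)].
have H2 : zspan 2 (sectZ 2).
  rewrite S2 -!addrA; apply: ispanD; first exact: zspan_qcoef1.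
  apply: ispanD; apply: ispanN; first exact: (@tspan_nat _ _ 2%N 1%N).
  exact: (@tspan_nat _ _ 2%N 2%N).
have H3 : zspan 3 (sectZ 3).
  rewrite S3 -!addrA; apply: ispanD; first exact: zspan_qcoef1.
  apply: ispanD; first by apply/ispanN/zspan_qcoef2.
  by apply: ispanD; [apply: (@tspan_nat _ _ 3%N 0%N) | apply: (@tspan_nat _ _ 3%N 1%N)].
have H4 : zspan 4 (sectZ 4).
  rewrite S4 -!addrA; apply: ispanD; first exact: zspan_qcoef1.
  apply: ispanD; first by apply/ispanN/zspan_qcoef2.
  apply: ispanD; first exact: zspan_qcoef3.
  by apply/ispanN/(@tspan_nat _ _ 4%N 0%N).
elim/ltn_ind: k => -[//|[|[|[|[|k]]]]] IH _ //.
rewrite -[k.+1.+4]/(5 + k)%N (sectZ_rec iota_inj).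
have H m : (0 < m)%N -> (m < 5 + k)%N -> zspan m (sectZ m) by move=> m0 mk; apply: IH.
apply: ispanD; last first.
  (* At index 5 the recurrence reaches [U(Z^0) = 1], which has a term [t^0] and is outside the
     spans; its contribution [t^3] is treated directly. *)
  case: k {IH} H => [|k] H; last by apply: zspan_qcoef5 => //; apply: H => //; lia.
  by rewrite sectZ0 mulr1 -[t ^+ 3]mul1r; apply: (@tspan_nat _ _ 1%N 0%N).
apply: ispanD; last by apply/ispanN/zspan_qcoef4 => //; apply: H => //; lia.
apply: ispanD; last by apply: zspan_qcoef3 => //; apply: H => //; lia.
apply: ispanD; last by apply/ispanN/zspan_qcoef2 => //; apply: H => //; lia.
by apply: zspan_qcoef1 => //; apply: H => //; lia.
Qed.

Definition mspan := tspan (fun j => (5 * j - 5) %/ 3)%N 1.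

Lemma euler12_neq0 : euler12 != 0.
Proof. by apply: contraTneq euler12_unit => ->; rewrite unitr0. Qed.

(** Both sides are [q^6 F_25^2 / F^2]. *)
Lemma Zser_sqr : Zser ^+ 2 = dil 5 t * t.
Proof.
have c0 := euler12_neq0; have d0 : dil 5 euler12 != 0 by rewrite dil_neq0.
have t5 : dil 5 t * dil 5 euler12 ^+ 2 = q ^+ 5 * dil 25 euler12 ^+ 2.
  have ms d (f g : fps R) : dil d (f * g ^+ 2) = dil d f * dil d g ^+ 2.
    by rewrite (rmorphM (@dil R d)) rmorphXn.
  by rewrite -ms tser_euler12 ms dil_fq // dil_dil.
apply: (mulIf (expf_neq0 2 (mulf_neq0 c0 d0))).
transitivity ((Zser * euler12) ^+ 2 * dil 5 euler12 ^+ 2); first by ring.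
rewrite Zser_euler12.
transitivity ((dil 5 t * dil 5 euler12 ^+ 2) * (t * euler12 ^+ 2)); last by ring.
by rewrite t5 tser_euler12; ring.
Qed.

Lemma tser_neq0 : t != 0.
Proof.
apply/eqP => t0; have /eqP := tser_euler12.
by rewrite t0 mul0r eq_sym mulf_eq0 expf_eq0 (negPf (fq_neq0 _)) (negPf (dil_neq0 _ euler12_neq0)).
Qed.

(** From [Z^(2i) = T^i t^i] follows [U(Z^(2i)) = t^i U(t^i)], and [t^i] is cancelled. Odd powers of
    [Z] give [U(Z t^i)] in the same way. *)
Lemma sect_tX i : (0 < i)%N ->
  tspan (fun j => (5 * (i + j)).-1 %/ 3 - 2 * i)%N 1 (sect 5 (t ^+ i)).
Proof.
move=> i0; have : zspan (2 * i) (sectZ (2 * i)) by apply: sectZ_span; lia.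
have -> : sectZ (2 * i) = t ^+ i * sect 5 (t ^+ i).
  by rewrite /sectZ exprM Zser_sqr exprMn -rmorphXn sect_dilM.
rewrite /zspan (_ : (2 * i)./2.+1 = i + 1)%N; last by lia.
move=> /tspan_unshift [y /(mulfI (expf_neq0 i tser_neq0)) <-]; exact.
Qed.

Lemma sect_ZtX i : tspan (fun j => (5 * (i + j)).-1 %/ 3 - (2 * i).+1)%N 1 (sect 5 (Zser * t ^+ i)).
Proof.
have : zspan (2 * i).+1 (sectZ (2 * i).+1) by apply: sectZ_span.
have -> : sectZ (2 * i).+1 = t ^+ i * sect 5 (Zser * t ^+ i).
  by rewrite /sectZ exprS exprM Zser_sqr exprMn mulrCA -rmorphXn sect_dilM.
rewrite /zspan (_ : (2 * i).+1./2.+1 = i + 1)%N; last by lia.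
move=> /tspan_unshift [y /(mulfI (expf_neq0 i tser_neq0)) <-]; exact.
Qed.

Lemma sect_mspan x : mspan x -> exists2 y, sect 5 x = 5 * y & mspan y.
Proof.
elim=> [|m _ z [i i0 ->] _ [y zy My]]; first by exists 0; rewrite ?raddf0 ?mulr0 //; apply: ispan0.
have [u uE Mu] : exists2 u, sect 5 (5 ^+ ((5 * i - 5) %/ 3)%N * t ^+ i) = 5 * u & mspan u.
  have -> : sect 5 (5 ^+ ((5 * i - 5) %/ 3)%N * t ^+ i)
      = 5 ^+ ((5 * i - 5) %/ 3)%N * sect 5 (t ^+ i).
    rewrite -sect_dilM; congr (sect 5 (_ * _)); by rewrite rmorphXn rmorph_nat.
  elim: (sect_tX i0) => [|k _ v [j j0 ->] _ [u uE Mu]].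
    by exists 0; rewrite ?mulr0 //; apply: ispan0.
  set e := ((5 * i - 5) %/ 3)%N in uE *; set f := (_ - _)%N.
  (* For [i, j >= 1] the total exponent [e + f] is at least 1, which provides the factor 5, and the
     remaining [e + f - 1] still reaches [floor((5j-5)/3)]. *)
  have ef : (e + f = (e + f - 1).+1)%N by rewrite /e /f; lia.
  exists ((5 ^+ (e + f - 1) * t ^+ j) *~ k + u).
    by rewrite mulrDr uE mulrzAr mulrA -exprD {1}ef exprS mulrDr mulrzAr mulrA.
  apply: ispanD => //; apply: ispanMz; rewrite -[5 ^+ _]mul1r; apply: (tspan_term 1) => //.
  by rewrite /e /f; lia.
exists (u *~ m + y); last by apply: ispanD => //; apply: ispanMz.
by rewrite raddfD raddfMz /= uE zy mulrDr mulrzAr.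
Qed.

Lemma sect_Z_mspan x : mspan x -> mspan (sect 5 (Zser * x)).
Proof.
elim=> [|m _ z [i i0 ->] _ Mz]; first by rewrite mulr0 raddf0; apply: ispan0.
rewrite mulrDr raddfD mulrzAr raddfMz /=; apply: ispanD => //; apply: ispanMz.
have -> : sect 5 (Zser * (5 ^+ ((5 * i - 5) %/ 3)%N * t ^+ i))
   = 1%:R * 5 ^+ ((5 * i - 5) %/ 3)%N * t ^+ 0 * sect 5 (Zser * t ^+ i).
  rewrite mul1r mulr1 -sect_dilM mulrCA; congr (sect 5 (_ * _)); by rewrite rmorphXn rmorph_nat.
apply: tspan_mul (sect_ZtX i) => j j0; split=> //; lia.
Qed.

Lemma sectZ1_mspan : mspan (sectZ 1).
Proof.
have [-> _ _ _] := sectZ_low iota_inj; rewrite -[t in 3 * t]expr1.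
by do 2?apply: ispanD; [apply: (@tspan_nat _ _ 3%N 0%N) | apply: (@tspan_nat _ _ 1%N 2%N)
    | apply: (@tspan_nat _ _ 1%N 3%N)].
Qed.

(** * Cubic partitions in arithmetic progressions *)

Definition cubic_series := euler12^-1.

Lemma geom_truncE n k : (0 < k)%N ->
  agree n.+1 (fps_of_poly (geom_trunc n k) * (1 - q ^+ k)) 1.
Proof.
move=> k0; have -> : fps_of_poly (geom_trunc n k) = \sum_(i < n.+1) (q ^+ k) ^+ i.
  rewrite rmorph_sum; apply: eq_bigr => i _.
  by rewrite rmorphXn /= fps_of_polyX exprM.
rewrite mulrC -opprB mulNr -subrX1 opprB; apply/agreeB0.
rewrite addrAC subrr add0r -exprM -mulN1r; apply: agree_cqX.
by rewrite leq_pmull.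
Qed.

(** Both sides are compared after multiplication by [F], whose constant term is 1: each truncated
    geometric series times its factor [1 - q^k] is 1 up to degree [n]. *)
Lemma cubic_partE n : cubic_part n = coef cubic_series n.
Proof.
set p := \prod_(1 <= k < n.+1) (geom_trunc n k * geom_trunc n (2 * k)).
rewrite -[LHS]/(coef (fps_of_poly p) n).
have cub1 : coef euler12 0 = 1 by rewrite fcoefM big_ord1 euler0 // -(dil1 (euler R)) euler0.
suff pcub : agree n.+1 (fps_of_poly p * euler12) (cubic_series * euler12).
  exact: (agree_cancel cub1 pcub).
rewrite mulVr ?euler12_unit //.
apply: (@agree_trans _ _ _ (fps_of_poly p * (qfact q n * qfact (q ^+ 2) n))).
  apply: agreeM => //; rewrite /euler12 -{1}(dil1 (euler R)) -[q in qfact q]expr1.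
  by apply: agreeM; apply: agree_euler.
have -> : fps_of_poly p * (qfact q n * qfact (q ^+ 2) n)
    = \prod_(k < n) (fps_of_poly (geom_trunc n k.+1) * (1 - q ^+ k.+1)
        * (fps_of_poly (geom_trunc n (2 * k.+1)) * (1 - q ^+ (2 * k.+1)))).
  rewrite /p big_add1 big_mkord rmorph_prod /qfact -!big_split; apply: eq_bigr => k _ /=.
  by rewrite rmorphM /= -exprM; ring.
apply: (@agree_trans _ _ _ (\prod_(k < n) (1 * 1))); last by rewrite big1 // => k _; rewrite mulr1.
by apply: agree_prod => k _; apply: agreeM; apply: geom_truncE.
Qed.

(** This is [(7 * 25^(alpha+1) + 1) / 8], the inverse of 8 modulo [25^(alpha+1)]; the coefficient 21
    is [7 * 24 / 8]. *)
Fixpoint residue25 alpha := if alpha is a.+1 then (21 * 25 ^ a.+1 + residue25 a)%N else 22.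

Lemma residue25E alpha : (8 * residue25 alpha = (7 * 25 ^ alpha.+1).+1)%N.
Proof. by elim: alpha => //= a IH; rewrite mulnDr IH !expnS; lia. Qed.

Definition progression alpha :=
  Fps (fun n => coef cubic_series (25 ^ alpha.+1 * n + residue25 alpha)).

(** Index [25 (n+1)] of [q^k f] is index [25 n + (25 - k)] of [f]; the factor [q] records the shift,
    and at index 0 both sides vanish. *)
Lemma sect25 k (f : fps R) : (0 < k <= 25)%N ->
  sect 5 (sect 5 (q ^+ k * f)) = q * Fps (fun n => coef f (25 * n + (25 - k))).
Proof.
move=> k25; apply: fpsP => n; rewrite -[LHS]/(coef (q ^+ k * f) (5 * (5 * n))) fcoefqXM fcoefqM.
case: n => [|n] /=; first by rewrite !muln0 ifT //; lia.
by rewrite ifF; [congr coef; lia | lia].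
Qed.

(** Two applications of [U] to [Z] times the previous series advance [alpha] by one:
    [Z F = q^3 F_25], and [F_25] leaves them as [F]. The inner [U] preserves [mspan], and the outer
    one gains 5. *)
Lemma progression_mspan alpha :
  exists2 y, euler12 * (q * progression alpha) = 5 ^+ alpha.+1 * y & mspan y.
Proof.
have sect2 x : sect 5 (sect 5 (dil 25 euler12 * x)) = euler12 * sect 5 (sect 5 x).
  by rewrite -(@dil_dil _ 5 5) // !sect_dilM.
elim: alpha => [|alpha [y yE My]].
  (* The first factor 5 arises from [U(U(Z))], and [q^3] gives the initial residue [25 - 3 = 22]. *)
  have [y yE My] := sect_mspan sectZ1_mspan; exists y => //.
  rewrite expr1 -yE /sectZ expr1.
  have -> : Zser = dil 25 euler12 * (q ^+ 3 * cubic_series) by rewrite mulrCA mulrA.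
  by rewrite sect2 sect25.
have [u uE Mu] := sect_mspan (sect_Z_mspan My); exists u => //.
rewrite exprSr -mulrA -uE.
have sc (c : nat) x : sect 5 (c%:R * x) = c%:R * sect 5 x.
  by rewrite -[c%:R in LHS](rmorph_nat (@dil R 5)) sect_dilM.
transitivity (sect 5 (sect 5 (Zser * (5 ^+ alpha.+1 * y)))); last by rewrite mulrCA -natrX !sc.
rewrite -yE.
(* The factor [q^3] of [Z] and the factor [q] of the previous stage combine to [q^4]; [25 - 4 = 21]
   is the coefficient in [residue25]. *)
have -> : Zser * (euler12 * (q * progression alpha))
    = dil 25 euler12 * (q ^+ 4 * progression alpha).
  by rewrite mulrA Zser_euler12; ring.
rewrite sect2 sect25 //; congr (_ * (_ * _)); apply: fpsP => n /=; congr (coef _ _).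
by rewrite !expnS; lia.
Qed.

(** Multiplication by [1 / F], a series with integer coefficients, preserves divisibility; the index
    [n.+1] accounts for the factor [q]. *)
Lemma dvd_progression alpha n : ((5 ^ alpha.+1)%:Z %| coef (progression alpha) n)%Z.
Proof.
have [y yE _] := progression_mspan alpha.
have -> : coef (progression alpha) n = coef (cubic_series * (5 ^+ alpha.+1 * y)) n.+1.
  by rewrite -yE mulKr ?euler12_unit // fcoefqM.
by rewrite mulrCA -natrX mulr_natl fcoefMn -mulr_natr natz dvdz_mull.
Qed.

End Spans.

Local Close Scope ring_scope.

Lemma eq_of_mod8 m a b : coprime m 8 -> a < m -> b < m -> 8 * a == 8 * b %[mod m] -> a = b.
Proof.
wlog le_ab : a b / a <= b => [IH|] cop am bm ab.
  by have [/IH|/ltnW/IH] := leqP a b; [apply | move/(_ cop bm am) ->; rewrite // eq_sym].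
move: ab; rewrite eq_sym eqn_mod_dvd ?leq_mul2l // -mulnBr Gauss_dvdr // /dvdn modn_small; lia.
Qed.

Theorem theorem1p4 (alpha n delta : nat) :
  (delta < 5 ^ (2 * alpha + 2))%N ->
  (8 * delta == 1 %[mod 5 ^ (2 * alpha + 2)])%N ->
  ((5 ^ (alpha + 1))%:Z %| cubic_part (5 ^ (2 * alpha + 2) * n + delta))%Z.
Proof.
have -> : 5 ^ (2 * alpha + 2) = 25 ^ alpha.+1 by rewrite -[25]/(5 ^ 2) -expnM; congr (_ ^ _); lia.
move=> lt_delta delta8.
(* Both are inverses of 8 modulo [25^(alpha+1)] lying below the modulus. *)
have -> : delta = residue25 alpha.
  apply: (@eq_of_mod8 (25 ^ alpha.+1)) => //; first by rewrite coprimeXl.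
    have m1 : 1 < 25 ^ alpha.+1 by rewrite -[1]/(25 ^ 0) ltn_exp2l.
    by rewrite -(ltn_pmul2l (isT : 0 < 8)) residue25E; lia.
  by rewrite (eqP delta8) residue25E -[(7 * _).+1]addn1 modnMDl.
by rewrite addn1 cubic_partE; apply: dvd_progression.
Qed.
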